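(* Let $\mathcal{A}$ be an abelian category, let $(\mathcal{X},\mathcal{Y})$ be a GP-admissible pair and $(\mathcal{Z},\mathcal{W})$ a GI-admissible pair in $\mathcal{A}$ such that $\mathcal{GP}_{(\mathcal{X},\mathcal{Y})}^{\wedge}=\mathcal{A}=\mathcal{GI}_{(\mathcal{Z},\mathcal{W})}^{\vee}$. Then $\mathrm{gl.GPD}_{(\mathcal{X},\mathcal{Y})}(\mathcal{A})=\mathrm{gl.GID}_{(\mathcal{Z},\mathcal{W})}(\mathcal{A})$.
   Context: $\mathrm{Proj}(\mathcal{A})$ and $\mathrm{Inj}(\mathcal{A})$ are the classes of projective and injective objects of $\mathcal{A}$. Write $\mathcal{X}\perp\mathcal{Y}$ if $\mathrm{Ext}^i_{\mathcal{A}}(X,Y)=0$ for all $X\in\mathcal{X}$, $Y\in\mathcal{Y}$, $i>0$. A pair $(\mathcal{X},\mathcal{Y})$ of classes of objects of $\mathcal{A}$ is GP-admissible if: every $A\in\mathcal{A}$ admits an epimorphism $X\to A$ with $X\in\mathcal{X}$; $\mathcal{X}$ and $\mathcal{Y}$ are closed under finite coproducts and $\mathcal{X}$ is closed under extensions; for every $X\in\mathcal{X}$ there is a short exact sequence $0\to X\to W\to X'\to 0$ with $W\in\mathcal{X}\cap\mathcal{Y}$ and $X'\in\mathcal{X}$; and $\mathcal{X}\perp\mathcal{Y}$. Dually, $(\mathcal{Z},\mathcal{W})$ is GI-admissible if: every $A\in\mathcal{A}$ admits a monomorphism $A\to W$ with $W\in\mathcal{W}$; $\mathcal{Z}$ and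 $\mathcal{W}$ are closed under finite coproducts and $\mathcal{W}$ is closed under extensions; for every $W\in\mathcal{W}$ there is a short exact sequence $0\to W'\to V\to W\to 0$ with $V\in\mathcal{Z}\cap\mathcal{W}$ and $W'\in\mathcal{W}$; and $\mathcal{Z}\perp\mathcal{W}$. Standing assumptions: GP-admissible pairs satisfy $\mathcal{X}\cap\mathcal{Y}=\mathrm{Proj}(\mathcal{A})$ and GI-admissible pairs satisfy $\mathcal{Z}\cap\mathcal{W}=\mathrm{Inj}(\mathcal{A})$. $\mathcal{GP}_{(\mathcal{X},\mathcal{Y})}$ is the class of objects that are cycles of an exact complex $X_\bullet$ (indexed by $\mathbb{Z}$) with all $X_m\in\mathcal{X}$ such that $\mathrm{Hom}_{\mathcal{A}}(X_\bullet,Y)$ is exact for all $Y\in\mathcal{Y}$. $\mathcal{GI}_{(\mathcal{Z},\mathcal{W})}$ is the class of objects that are cycles of an exact complex $W_\bullet$ with all $W_m\in\mathcal{W}$ such that $\mathrm{Hom}_{\mathcal{A}}(Z,W_\bullet)$ is exact for all $Z\in\mathcal{Z}$. For a class $\mathcal{C}$, $\mathrm{resdim}_{\mathcal{C}}(M)$ is the least $n\ge0$ for which there is an exact sequence $0\to C_n\to\cdots\to C_0\to M\to0$ with $C_i\in\mathcal{C}$ ($\infty$ if there is none), $\mathrm{coresdim}_{\mathcal{C}}(M)$ is the least $n\ge 0$ for which there is an exact sequence $0\to M\to C_0\to\cdots\to C_n\to0$ with $C_i\in\mathcal{C}$ ($\infty$ if there is none); $\mathcal{C}^{\wedge}$ (resp.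 $\mathcal{C}^{\vee}$) is the class of objects of finite $\mathcal{C}$-resolution (resp. $\mathcal{C}$-coresolution) dimension. Finally $\mathrm{gl.GPD}_{(\mathcal{X},\mathcal{Y})}(\mathcal{A})=\sup_{A\in\mathcal{A}}\mathrm{resdim}_{\mathcal{GP}_{(\mathcal{X},\mathcal{Y})}}(A)$ and $\mathrm{gl.GID}_{(\mathcal{Z},\mathcal{W})}(\mathcal{A})=\sup_{A\in\mathcal{A}}\mathrm{coresdim}_{\mathcal{GI}_{(\mathcal{Z},\mathcal{W})}}(A)$. *)

(* Defs.v *)
From HB Require Import structures.
From mathcomp Require Import all_boot all_order all_algebra.
From mathcomp Require Import boolp classical_sets.
From Stdlib Require Import Relation_Operators.

Set Implicit Arguments.
Unset Strict Implicit.
Unset Printing Implicit Defensive.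
Import GRing.Theory.

Local Open Scope classical_set_scope.
Local Open Scope ring_scope.

Record preadditive := Preadditive {
  obj :> Type;
  hom : obj -> obj -> zmodType;
  idm : forall A, hom A A;
  comp : forall A B C, hom B C -> hom A B -> hom A C;
  compA : forall A B C D (h : hom C D) (g : hom B C) (f : hom A B),
    comp h (comp g f) = comp (comp h g) f;
  comp1m : forall A B (f : hom A B), comp (idm B) f = f;
  compm1 : forall A B (f : hom A B), comp f (idm A) = f;
  compDl : forall A B C (g g' : hom B C) (f : hom A B),
    comp (g + g') f = comp g f + comp g' f;
  compDr : forall A B C (g : hom B C) (f f' : hom A B),
    comp g (f + f') = comp g f + comp g f'
}.

Arguments hom {p} _ _.
Arguments idm {p} A.
Arguments comp {p A B C} _ _.

Notation "g '\oc' f" := (comp g f) (at level 40, left associativity).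

Section Basics.
Variable K : preadditive.
Implicit Types A B C M X Y Z : K.

Definition mono A B (f : hom A B) : Prop :=
  forall Z (u v : hom Z A), f \oc u = f \oc v -> u = v.

Definition epi A B (f : hom A B) : Prop :=
  forall Z (u v : hom B Z), u \oc f = v \oc f -> u = v.

Definition iso A B (f : hom A B) : Prop :=
  exists g : hom B A, g \oc f = idm A /\ f \oc g = idm B.

Definition is_zero Z : Prop :=
  (forall A (f : hom A Z), f = 0) /\ (forall A (f : hom Z A), f = 0).

Definition is_kernel N A B (f : hom A B) (k : hom N A) : Prop :=
  f \oc k = 0 /\
  forall Z (u : hom Z A), f \oc u = 0 -> exists! v : hom Z N, k \oc v = u.

Definition is_cokernel A B Q (f : hom A B) (q : hom B Q) : Prop :=
  q \oc f = 0 /\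
  forall Z (u : hom B Z), u \oc f = 0 -> exists! v : hom Q Z, v \oc q = u.

Definition is_biproduct A B S (i1 : hom A S) (i2 : hom B S)
    (p1 : hom S A) (p2 : hom S B) : Prop :=
  [/\ p1 \oc i1 = idm A, p2 \oc i2 = idm B, p1 \oc i2 = 0, p2 \oc i1 = 0 &
      i1 \oc p1 + i2 \oc p2 = idm S].

Definition is_coproduct n (F : 'I_n -> K) S (i : forall j, hom (F j) S) : Prop :=
  forall Z (u : forall j, hom (F j) Z),
    exists! v : hom S Z, forall j, v \oc i j = u j.

(* [exact_at f g]: the image of [f] is the kernel of [g], i.e. [f] factors
   as an epimorphism followed by a kernel of [g]. *)
Definition exact_at A B C (f : hom A B) (g : hom B C) : Prop :=
  exists N (k : hom N B) (e : hom A N),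
    [/\ is_kernel g k, epi e & f = k \oc e].

Definition short_exact A B C (f : hom A B) (g : hom B C) : Prop :=
  [/\ mono f, exact_at f g & epi g].

Definition projective : set K := [set P | forall B C (g : hom B C) (f : hom P C),
  epi g -> exists h : hom P B, g \oc h = f].

Definition injective_obj : set K := [set I | forall B C (g : hom B C) (f : hom B I),
  mono g -> exists h : hom C I, h \oc g = f].

End Basics.

Arguments projective K : clear implicits.
Arguments injective_obj K : clear implicits.

Record abelian (K : preadditive) : Prop := Abelian {
  has_zero : exists Z : K, is_zero Z;
  has_biproducts : forall A B : K,
    exists S (i1 : hom A S) (i2 : hom B S) p1 p2, is_biproduct i1 i2 p1 p2;
  has_kernels : forall (A B : K) (f : hom A B),
    exists N (k : hom N A), is_kernel f k;
  has_cokernels : forall (A B : K) (f : hom A B),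
    exists Q (q : hom B Q), is_cokernel f q;
  mono_normal : forall (A B : K) (f : hom A B),
    mono f -> exists C (g : hom B C), is_kernel g f;
  epi_normal : forall (A B : K) (f : hom A B),
    epi f -> exists C (g : hom C A), is_cokernel g f
}.

Section Ext.
Variable K : preadditive.
Implicit Types A B C M X Y Z : K.

(* ... -> C_2 -> C_1 -> C_0 -> M -> 0 is exact. *)
Definition left_resolution M (C : nat -> K)
    (d : forall k, hom (C k.+1) (C k)) (e : hom (C 0%N) M) : Prop :=
  [/\ epi e, exact_at (d 0%N) e & forall k, exact_at (d k.+1) (d k)].

(* 0 -> M -> C_0 -> C_1 -> C_2 -> ... is exact. *)
Definition right_resolution M (C : nat -> K)
    (d : forall k, hom (C k) (C k.+1)) (e : hom M (C 0%N)) : Prop :=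
  [/\ mono e, exact_at e (d 0%N) & forall k, exact_at (d k) (d k.+1)].

(* An n-extension 0 -> Y -> E_(n-1) -> ... -> E_0 -> X -> 0, for n > 0.
   To avoid transport along equalities of objects, it is stored as an exact
   complex ... -> 0 -> 0 -> E_n -> E_(n-1) -> ... -> E_0 -> X -> 0 with an
   isomorphism between Y and E_n. *)
Record extension (n : nat) (X Y : K) := Extension {
  ext_obj : nat -> K;
  ext_d : forall k, hom (ext_obj k.+1) (ext_obj k);
  ext_aug : hom (ext_obj 0%N) X;
  ext_end : hom Y (ext_obj n);
  ext_exact : left_resolution ext_d ext_aug;
  ext_iso : iso ext_end;
  ext_bound : forall k, (n < k)%N -> is_zero (ext_obj k)
}.

(* Morphisms of n-extensions are the identity on X and Y. *)
Definition ext_morphism n X Y (E E' : extension n X Y) : Prop :=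
  exists f : forall k, hom (ext_obj E k) (ext_obj E' k),
    [/\ forall k, f k \oc ext_d E k = ext_d E' k \oc f k.+1,
        ext_aug E' \oc f 0%N = ext_aug E &
        f n \oc ext_end E = ext_end E'].

(* Ext^n(X, Y), for n > 0, as the set of classes of n-extensions for the
   equivalence relation generated by the existence of a morphism. *)
Definition Ext n X Y : set (set (extension n X Y)) :=
  range (fun E => [set E' | clos_refl_sym_trans _ (@ext_morphism n X Y) E E']).

Arguments Ext n X Y : clear implicits.

(* The group Ext^n(X, Y) vanishes iff it has at most one element; the Baer
   sum is therefore not needed to express this. *)
Definition Ext_vanish n X Y : Prop := is_subset1 (Ext n X Y).

Definition ext_perp (CX CY : set K) : Prop :=
  forall X Y i, CX X -> CY Y -> (0 < i)%N -> Ext_vanish i X Y.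

End Ext.

Section Admissible.
Variable K : preadditive.
Implicit Types CX CY CZ CW C : set K.

(* Every coproduct object is allowed, so that such a class is closed under
   isomorphisms and contains the zero objects (the empty coproducts). *)
Definition coproduct_closed C : Prop :=
  forall n (F : 'I_n -> K) (S : K) (i : forall j, hom (F j) S),
    is_coproduct i -> (forall j, C (F j)) -> C S.

Definition extension_closed C : Prop :=
  forall (A B D : K) (f : hom A B) (g : hom B D),
    short_exact f g -> C A -> C D -> C B.

Record GP_admissible CX CY : Prop := GPAdmissible {
  GPa_epi : forall A : K, exists X (p : hom X A), CX X /\ epi p;
  GPa_coprodX : coproduct_closed CX;
  GPa_coprodY : coproduct_closed CY;
  GPa_extX : extension_closed CX;
  GPa_cogen : forall X, CX X ->
    exists W X' (f : hom X W) (g : hom W X'),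
      [/\ short_exact f g, (CX `&` CY) W & CX X'];
  GPa_perp : ext_perp CX CY
}.

Record GI_admissible CZ CW : Prop := GIAdmissible {
  GIa_mono : forall A : K, exists W (i : hom A W), CW W /\ mono i;
  GIa_coprodZ : coproduct_closed CZ;
  GIa_coprodW : coproduct_closed CW;
  GIa_extW : extension_closed CW;
  GIa_gen : forall W, CW W ->
    exists V W' (f : hom W' V) (g : hom V W),
      [/\ short_exact f g, (CZ `&` CW) V & CW W'];
  GIa_perp : ext_perp CZ CW
}.

End Admissible.

Definition exact_grp (U V W : zmodType) (f : U -> V) (g : V -> W) : Prop :=
  range f = g @^-1` [set 0].

Section Gorenstein.
Variable K : preadditive.
Implicit Types CX CY CZ CW : set K.

Definition exact_complex (X : int -> K) (d : forall m, hom (X (m + 1)) (X m)) :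
    Prop := forall m, exact_at (d (m + 1)) (d m).

Definition is_cycle (X : int -> K) (d : forall m, hom (X (m + 1)) (X m))
    (M : K) : Prop :=
  exists m (i : hom M (X (m + 1))), is_kernel (d m) i.

Definition GP CX CY : set K := [set M |
  exists (X : int -> K) (d : forall m, hom (X (m + 1)) (X m)),
    [/\ exact_complex d, forall m, CX (X m),
        forall Y, CY Y -> forall m,
          exact_grp (fun u : hom (X m) Y => u \oc d m)
                    (fun u : hom (X (m + 1)) Y => u \oc d (m + 1))
      & is_cycle d M]].

Definition GI CZ CW : set K := [set M |
  exists (W : int -> K) (d : forall m, hom (W (m + 1)) (W m)),
    [/\ exact_complex d, forall m, CW (W m),
        forall Z, CZ Z -> forall m,
          exact_grp (fun u : hom Z (W (m + 1 + 1)) => d (m + 1) \oc u)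
                    (fun u : hom Z (W (m + 1)) => d m \oc u)
      & is_cycle d M]].

End Gorenstein.

Definition enat : Type := option nat.
Definition einfty : enat := None.

Definition le_enat (x y : enat) : Prop :=
  match x, y with
  | _, None => True
  | None, Some _ => False
  | Some m, Some n => (m <= n)%N
  end.

(* The least element of [P], or infinity if [P] is empty. *)
Definition enat_least (P : set nat) : enat :=
  if pselect (exists n, `[< P n >]) is left h then Some (ex_minn h) else einfty.

(* The supremum is the least natural number that is an upper bound, or
   infinity if there is none; see [enat_sup_ub] and [enat_sup_least]. *)
Definition enat_sup (S : set enat) : enat :=
  enat_least [set n | forall x, S x -> le_enat x (Some n)].

Lemma enat_sup_ub (S : set enat) x : S x -> le_enat x (enat_sup S).
Proof.
rewrite /enat_sup /enat_least; case: pselect => [h|_] Sx; last by case: x Sx.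
by case: ex_minnP => m /asboolP + _; apply.
Qed.

Lemma enat_sup_least (S : set enat) y :
  (forall x, S x -> le_enat x y) -> le_enat (enat_sup S) y.
Proof.
rewrite /enat_sup /enat_least; case: y => [n|] Sy; last by case: pselect.
case: pselect => [h|[]]; last by exists n; apply/asboolP.
by case: ex_minnP => m _; apply; apply/asboolP.
Qed.

Section Dimensions.
Variable K : preadditive.
Implicit Types (C : set K) (M : K).

(* 0 -> C_n -> ... -> C_0 -> M -> 0 is exact, with all C_i in C; the sequence
   is extended by C_k = 0 for k > n. *)
Definition has_resolution C M (n : nat) : Prop :=
  exists (R : nat -> K) (d : forall k, hom (R k.+1) (R k)) (e : hom (R 0%N) M),
    [/\ left_resolution d e, forall k, (k <= n)%N -> C (R k)
      & forall k, (n < k)%N -> is_zero (R k)].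

Definition has_coresolution C M (n : nat) : Prop :=
  exists (R : nat -> K) (d : forall k, hom (R k) (R k.+1)) (e : hom M (R 0%N)),
    [/\ right_resolution d e, forall k, (k <= n)%N -> C (R k)
      & forall k, (n < k)%N -> is_zero (R k)].

Definition resdim C M : enat := enat_least [set n | has_resolution C M n].
Definition coresdim C M : enat := enat_least [set n | has_coresolution C M n].

Definition wedge C : set K := [set M | resdim C M <> einfty].
Definition vee C : set K := [set M | coresdim C M <> einfty].

Definition glGPD (CX CY : set K) : enat := enat_sup (range (resdim (GP CX CY))).
Definition glGID (CZ CW : set K) : enat := enat_sup (range (coresdim (GI CZ CW))).

End Dimensions.

(* Main.v *)
From mathcomp Require Import all_boot all_order all_algebra.
From mathcomp Require Import boolp classical_sets.
From Stdlib Require Import Relation_Operators.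
Require Import Defs.

Set Implicit Arguments.
Unset Strict Implicit.
Unset Printing Implicit Defensive.
Import GRing.Theory.
Local Open Scope classical_set_scope.
Local Open Scope ring_scope.

(** Both global dimensions are governed by the homological dimensions of the
    projectives and of the injectives. When all objects have GP-resolutions and
    GI-coresolutions of some finite length, then for every n, all objects have
    GP-resolutions of length n if and only if all injectives are retracts of
    objects of projective dimension at most n, if and only if all objects have
    GI-coresolutions of length n. By duality it is enough to see that
    GI-coresolutions of length n give GP-resolutions of length n.

    The bridge is the Auslander-Buchweitz embedding [cores_embedding]: an
    object M with a GP-resolution of length n fits into a short exact sequence
    0 -> M -> H -> G -> 0 with H of projective dimension at most n and G
    coresolved by projectives, with the same Ext-orthogonality as the members
    of GP. If M is injective the sequence splits. Dually, if all objects have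
    GI-coresolutions of length n, each projective Q is a retract of an object
    of injective dimension at most n, so that Ext^i(-, Q) = 0 for i > n. The
    n-th syzygy C of any object then satisfies Ext^i(C, Q) = 0 for all i > 0
    and all projectives Q. Applied to C, the embedding 0 -> C -> H -> G -> 0
    has an H of finite projective dimension without Ext into projectives, and
    therefore a projective H; so C is the kernel of H -> G, and this makes it a
    member of GP ([ext_vanish_gorenstein]).

    Nothing in the hypotheses provides projective or injective covers. They are
    obtained first, from the two embeddings: injectives are retracts of objects
    of finite projective dimension, every object is a quotient of one of finite
    injective dimension, and having a projective presentation is inherited by
    extensions, retracts and kernels of epimorphisms
    ([enough_projectivesP]). This step only uses Ext^1, that is, the splitting
    of short exact sequences ([E1]).

    With enough projectives and injectives, the vanishing of higher Ext can be
    expressed by dimension shifting from [E1], in the first argument ([ExtP])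
    or in the second ([ExtI]); the two are equivalent by [ExtIP], which makes
    the long exact sequences short diagram chases. That the vanishing of
    Yoneda's Ext implies these conditions ([Ext_vanish_ExtP]) comes from the
    comparison of an extension with a projective resolution. Finally, the
    complexes in the definitions of GP and GI are traded for the coinductive
    condition [gorenstein], which avoids indices and is the same condition for
    GP and, in the opposite category, for GI. *)

(** * Preadditive categories and duality *)

Section Preadditive.
Variable K : preadditive.
Implicit Types A B C D P Q X Y Z : K.

Lemma compm0 A B C (g : hom B C) : g \oc (0 : hom A B) = 0.
Proof. by apply: (addrI (g \oc 0)); rewrite -compDr !addr0. Qed.

Lemma comp0m A B C (f : hom A B) : (0 : hom B C) \oc f = 0.
Proof. by apply: (addrI (0 \oc f)); rewrite -compDl !addr0. Qed.

Lemma compmN A B C (g : hom B C) (f : hom A B) : g \oc (- f) = - (g \oc f).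
Proof. by apply: (addrI (g \oc f)); rewrite -compDr !subrr compm0. Qed.

Lemma compNm A B C (g : hom B C) (f : hom A B) : (- g) \oc f = - (g \oc f).
Proof. by apply: (addrI (g \oc f)); rewrite -compDl !subrr comp0m. Qed.

Lemma compmB A B C (g : hom B C) (f f' : hom A B) :
  g \oc (f - f') = g \oc f - g \oc f'.
Proof. by rewrite compDr compmN. Qed.

Lemma compBm A B C (g g' : hom B C) (f : hom A B) :
  (g - g') \oc f = g \oc f - g' \oc f.
Proof. by rewrite compDl compNm. Qed.

Lemma monoP A B (f : hom A B) :
  mono f <-> forall Z (u : hom Z A), f \oc u = 0 -> u = 0.
Proof.
split=> [mf Z u fu0 | mf Z u v fuv]; first by apply: mf; rewrite fu0 compm0.
by apply: subr0_eq; apply: mf; rewrite compmB fuv subrr.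
Qed.

Lemma epiP A B (f : hom A B) :
  epi f <-> forall Z (u : hom B Z), u \oc f = 0 -> u = 0.
Proof.
split=> [ef Z u fu0 | ef Z u v fuv]; first by apply: ef; rewrite fu0 comp0m.
by apply: subr0_eq; apply: ef; rewrite compBm fuv subrr.
Qed.

Lemma kernel_mono A B N (f : hom A B) (k : hom N A) : is_kernel f k -> mono k.
Proof.
move=> [fk kk]; apply/monoP => Z u ku0.
have [w [_ w_uniq]] := kk Z 0 (compm0 _ _).
by rewrite -(w_uniq u ku0) -(w_uniq 0 (compm0 _ _)).
Qed.

Lemma epi_idm A : epi (idm A).
Proof. by move=> Z u v; rewrite !compm1. Qed.

Lemma epi_comp A B C (g : hom B C) (f : hom A B) :
  epi g -> epi f -> epi (g \oc f).
Proof. by move=> eg ef Z u v; rewrite !compA => /ef/eg. Qed.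

Lemma epi_of_comp A B C (g : hom B C) (f : hom A B) : epi (g \oc f) -> epi g.
Proof. by move=> egf Z u v uv; apply: egf; rewrite !compA uv. Qed.

Lemma biproduct_eq P Q R i1 i2 p1 p2 Z (x y : hom Z R) :
  @is_biproduct _ P Q R i1 i2 p1 p2 ->
  p1 \oc x = p1 \oc y -> p2 \oc x = p2 \oc y -> x = y.
Proof.
case=> _ _ _ _ ip e1 e2.
by rewrite -[x]comp1m -[y]comp1m -ip !compDl -!compA e1 e2.
Qed.

(** The definition is symmetric in kernels and cokernels, so that short exact
    sequences of the opposite category are those of the category. *)
Definition ses A B C (f : hom A B) (g : hom B C) : Prop :=
  is_kernel g f /\ is_cokernel f g.

(** Vanishing of Ext^1(A, B). By [splits_section] one could ask for a section
    instead of a retraction, so that this is a self-dual notion. *)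
Definition E1 A B : Prop :=
  forall E (f : hom B E) (g : hom E A), ses f g ->
    exists r : hom E B, r \oc f = idm B.

Section ShortExact.
Variables (A B C : K) (f : hom A B) (g : hom B C).
Hypothesis fg : ses f g.

Lemma ses_comp0 : g \oc f = 0. Proof. by case: fg => [[]]. Qed.

Lemma ses_inj Z (u : hom Z A) : f \oc u = 0 -> u = 0.
Proof.
case: fg => [[_ kf] _] fu0; have [w [_ w_uniq]] := kf Z 0 (compm0 _ _).
by rewrite -(w_uniq u fu0) -(w_uniq 0 (compm0 _ _)).
Qed.

Lemma ses_surj Z (u : hom C Z) : u \oc g = 0 -> u = 0.
Proof.
case: fg => [_ [_ cg]] ug0; have [w [_ w_uniq]] := cg Z 0 (comp0m _ _).
by rewrite -(w_uniq u ug0) -(w_uniq 0 (comp0m _ _)).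
Qed.

Lemma ses_mono : mono f. Proof. exact/monoP/ses_inj. Qed.
Lemma ses_epi : epi g. Proof. exact/epiP/ses_surj. Qed.

Lemma ses_ker Z (u : hom Z B) : g \oc u = 0 -> exists v, f \oc v = u.
Proof. by case: fg => [[_ kf] _] /kf[v [fv _]]; exists v. Qed.

Lemma ses_coker Z (u : hom B Z) : u \oc f = 0 -> exists v, v \oc g = u.
Proof. by case: fg => [_ [_ cg]] /cg[v [vg _]]; exists v. Qed.

Lemma splits_section (r : hom B A) : r \oc f = idm A ->
  exists s : hom C B, g \oc s = idm C /\ f \oc r + s \oc g = idm B.
Proof.
move=> rf; have [|s sg] := @ses_coker _ (idm B - f \oc r).
  by rewrite compBm comp1m -compA rf compm1 subrr.
exists s; split; last by rewrite sg addrC subrK.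
apply: ses_epi; rewrite -compA sg compmB compm1 compA ses_comp0 comp0m subr0.
by rewrite comp1m.
Qed.

Lemma splits_retraction (s : hom C B) : g \oc s = idm C ->
  exists r : hom B A, r \oc f = idm A /\ f \oc r + s \oc g = idm B.
Proof.
move=> gs; have [|r fr] := @ses_ker _ (idm B - s \oc g).
  by rewrite compmB compm1 compA gs comp1m subrr.
exists r; split; last by rewrite fr subrK.
apply: ses_mono; rewrite compA fr compBm compm1 -compA ses_comp0 compm0 subr0.
by rewrite comp1m.
Qed.

End ShortExact.

Lemma is_zero_eq Z (Z0 : is_zero Z) A (f g : hom A Z) : f = g.
Proof. by rewrite (Z0.1 _ f) (Z0.1 _ g). Qed.

Lemma ses_zero_l Z A : is_zero Z -> ses (0 : hom Z A) (idm A).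
Proof.
move=> Z0; split; split; rewrite ?comp1m ?compm0 // => Y u.
  rewrite comp1m => u0; exists 0; split=> [|v _]; last exact: is_zero_eq.
  by rewrite comp0m.
by exists u; split=> [|v]; rewrite compm1.
Qed.

Lemma ses_zero_r Z A : is_zero Z -> ses (idm A) (0 : hom A Z).
Proof.
move=> Z0; split; split; rewrite ?compm1 ?comp0m // => Y u.
  by exists u; split=> [|v]; rewrite comp1m.
rewrite compm1 => u0; exists 0; split=> [|v _]; last by rewrite (Z0.2 _ v).
by rewrite compm0.
Qed.

Lemma zero_projective Z : is_zero Z -> projective K Z.
Proof. by move=> Z0 B C g f _; exists 0; rewrite compm0 (Z0.2 _ f). Qed.

End Preadditive.

Arguments ses_comp0 {K A B C f g}.
Arguments ses_inj {K A B C f g} fg {Z u}.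
Arguments ses_surj {K A B C f g} fg {Z u}.
Arguments ses_ker {K A B C f g} fg {Z u}.
Arguments ses_coker {K A B C f g} fg {Z u}.

Definition op (K : preadditive) : preadditive :=
  @Preadditive K (fun A B => hom B A) (fun A => idm A)
    (fun A B C g f => f \oc g)
    (fun A B C D h g f => esym (compA f g h))
    (fun A B f => compm1 f) (fun A B f => comp1m f)
    (fun A B C g g' f => compDr f g g') (fun A B C g f f' => compDl f f' g).

Section Dual.
Variable K : preadditive.

Lemma op_ses (A B C : K) (f : hom A B) (g : hom B C) :
  ses f g -> @ses (op K) C B A g f.
Proof. by case. Qed.

Lemma ses_op (A B C : K) (f : hom A B) (g : hom B C) :
  @ses (op K) C B A g f -> ses f g.
Proof. by case. Qed.

Lemma op_injective (A : K) : projective (op K) A <-> injective_obj K A.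
Proof. by split=> H B C g f; exact: (H C B g f). Qed.

Lemma op_projective (A : K) : injective_obj (op K) A <-> projective K A.
Proof. by split=> H B C g f; exact: (H C B g f). Qed.

Lemma op_E1 (A B : K) : @E1 (op K) B A <-> E1 A B.
Proof.
split=> H E f g fg.
  have [s gs] := H E g f (op_ses fg).
  by have [r [rf _]] := splits_retraction fg gs; exists r.
have gf : @ses K B E A g f by exact: ses_op.
have [r rg] := H E g f gf.
by have [s [fs _]] := splits_section gf rg; exists s.
Qed.

Lemma op_zero (A : K) : @is_zero (op K) A <-> is_zero A.
Proof. by split=> -[]. Qed.

Lemma op_biproduct (A B S : K) (i1 : hom A S) (i2 : hom B S) p1 p2 :
  is_biproduct i1 i2 p1 p2 -> @is_biproduct (op K) A B S p1 p2 i1 i2.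
Proof. by case=> *; split. Qed.

Lemma op_abelian : abelian K -> abelian (op K).
Proof.
case=> hz hb hk hc mn en; split=> //.
- by have [Z Z0] := hz; exists Z; apply/op_zero.
- move=> A B; have [S [i1 [i2 [p1 [p2 h]]]]] := hb A B.
  by exists S, p1, p2, i1, i2; apply: op_biproduct.
- by move=> A B f; exact: (hc B A f).
- by move=> A B f; exact: (hk B A f).
- by move=> A B f; exact: (en B A f).
- by move=> A B f; exact: (mn B A f).
Qed.

End Dual.

(** * Short exact sequences in an abelian category *)

Section Abelian.
Variable K : preadditive.
Hypothesis hK : abelian K.
Implicit Types A B C D P Q X Y Z : K.

Lemma ses_of_epi B C (g : hom B C) :
  epi g -> exists A (f : hom A B), ses f g.
Proof.
move=> eg; have [A [f [gf kf]]] := has_kernels hK g.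
have [D [h [gh ch]]] := epi_normal hK eg.
exists A, f; split; split=> // Z u uf0; have [v [fv _]] := kf _ _ gh.
have [|w [wg _]] := ch Z u; first by rewrite -fv compA uf0 comp0m.
by exists w; split=> // w' w'g; apply: eg; rewrite wg.
Qed.

End Abelian.

Section AbelianDual.
Variable K : preadditive.
Hypothesis hK : abelian K.
Implicit Types A B C : K.

Lemma ses_of_mono A B (f : hom A B) :
  mono f -> exists C (g : hom B C), ses f g.
Proof.
move=> mf.
have [C [g /ses_op gf]] := @ses_of_epi (op K) (op_abelian hK) B A f mf.
by exists C, g.
Qed.

End AbelianDual.

Section Diagrams.
Variable K : preadditive.
Hypothesis hK : abelian K.
Implicit Types A B C D P Q X Y Z : K.

(** The kernel condition only has to be tested locally, on an epimorphic
    cover of the test object: [f] being a monomorphism, the local lifts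
    descend. *)
Lemma mk_ses A B C (f : hom A B) (g : hom B C) :
  mono f -> epi g -> g \oc f = 0 ->
  (forall Z (b : hom Z B), g \oc b = 0 ->
     exists Y (p : hom Y Z) (a : hom Y A), epi p /\ f \oc a = b \oc p) ->
  ses f g.
Proof.
move=> mf eg gf0 lift.
have [N [k [[gk kk] ck]]] := ses_of_epi hK eg.
have kf : is_kernel g f.
  split=> // Z b gb0; have [Y [p [a [ep fa]]]] := lift Z b gb0.
  have [L [l [[pl kl] [_ cl]]]] := ses_of_epi hK ep.
  have [|v [vp _]] := cl _ a.
    by apply: mf; rewrite compA fa -compA pl !compm0.
  have fv : f \oc v = b by apply: ep; rewrite -compA vp.
  by exists v; split=> // v' fv'; apply: mf; rewrite fv.
split=> //; split=> // Z u uf0; have [v [fv _]] := kf.2 _ _ gk.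
by apply: ck.2; rewrite -fv compA uf0 comp0m.
Qed.

Lemma mono_epi_iso A B (f : hom A B) : mono f -> epi f -> iso f.
Proof.
move=> mf ef; have [N [k kf]] := ses_of_epi hK ef.
have k0 : k = 0 by apply: (iffLR (monoP f) mf); exact: ses_comp0 kf.
have [|g gf] := ses_coker kf (u := idm A); first by rewrite k0 compm0.
exists g; split=> //; apply: ef; rewrite -compA gf comp1m.
by rewrite compm1.
Qed.

(** The new sequence is exact on the right because the pullback is the kernel
    of the epimorphism B + C' -> C, which is the cokernel of that kernel. *)
Lemma pull A B C (f : hom A B) (g : hom B C) C' (c : hom C' C) : ses f g ->
  exists E (f' : hom A E) (g' : hom E C') (b : hom E B),
    [/\ ses f' g', b \oc f' = f, g \oc b = c \oc g' &
     forall Z (u : hom Z B) (v : hom Z C'), g \oc u = c \oc v ->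
       exists w, b \oc w = u /\ g' \oc w = v].
Proof.
move=> fg; have [S [i1 [i2 [p1 [p2 bip]]]]] := has_biproducts hK B C'.
have [pi1 pi2 p12 p21 _] := bip.
pose h := g \oc p1 - c \oc p2.
have eh : epi h.
  apply: (@epi_of_comp _ _ _ _ _ i1); rewrite compBm -!compA pi1 p21 compm1.
  by rewrite compm0 subr0; exact: ses_epi fg.
have [E [k kh]] := ses_of_epi hK eh.
have gkc : g \oc (p1 \oc k) = c \oc (p2 \oc k).
  by apply: subr0_eq; rewrite !compA -compBm; exact: ses_comp0 kh.
have univ Z (u : hom Z B) (v : hom Z C') : g \oc u = c \oc v ->
    exists w, p1 \oc k \oc w = u /\ p2 \oc k \oc w = v.
  move=> uv; have [|w kw] := ses_ker kh (u := i1 \oc u + i2 \oc v).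
    rewrite compBm !compDr -!compA !(compA p1) !(compA p2) pi1 p12 p21 pi2.
    by rewrite !comp1m !comp0m !compm0 addr0 add0r uv subrr.
  exists w; rewrite -!compA kw !compDr !compA pi1 p12 p21 pi2.
  by rewrite !comp1m !comp0m addr0 add0r.
have [|f' [bf' g'f']] := univ _ f 0; first by rewrite compm0 (ses_comp0 fg).
exists E, f', (p2 \oc k), (p1 \oc k); split=> //; apply: mk_ses => //.
- apply/monoP => Z u f'u0; apply: (ses_inj fg).
  by rewrite -bf' -compA f'u0 compm0.
- (* If u p2 k = 0, then u p2 factors as v h; restricting to B gives v g = 0. *)
  apply/epiP => Z u upk0.
  have [|v vh] := ses_coker kh (u := u \oc p2); first by rewrite -compA.
  have v0 : v = 0.
    apply: (ses_surj fg); have := congr1 (fun t => t \oc i1) vh.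
    by rewrite /h compmB compBm -!compA pi1 p21 !compm0 compm1 subr0.
  by rewrite -(compm1 u) -pi2 compA -vh v0 !comp0m.
- move=> Z e g'e0; have [|a fa] := ses_ker fg (u := p1 \oc k \oc e).
    by rewrite compA gkc -compA g'e0 compm0.
  exists Z, (idm Z), a; split; first exact: epi_idm.
  rewrite compm1; apply: (ses_mono kh); apply: (biproduct_eq bip).
    by rewrite !compA bf' fa.
  by rewrite !compA g'f' g'e0 comp0m.
Qed.

Lemma local_lift A B (f : hom A B) : epi f -> forall Z (b : hom Z B),
  exists Y (p : hom Y Z) (a : hom Y A), epi p /\ f \oc a = b \oc p.
Proof.
move=> ef Z b; have [N [k kf]] := ses_of_epi hK ef.
have [E [f' [p [a [fp _ fa _]]]]] := pull b kf.
by exists E, p, a; split=> //; exact: ses_epi fp.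
Qed.

Lemma pull_epi A B C (f : hom A B) (g : hom B C) A' C' (c' : hom A' C')
    (c : hom C' C) : ses f g -> ses c' c ->
  exists E (f' : hom A E) (g' : hom E C') (k : hom A' E) (b : hom E B),
    [/\ ses f' g', ses k b, b \oc f' = f & g' \oc k = c'].
Proof.
move=> fg cc; have [E [f' [g' [b [fg' bf' gb univ]]]]] := pull c fg.
have [|k [bk g'k]] := univ A' 0 c'; first by rewrite compm0 (ses_comp0 cc).
exists E, f', g', k, b; split=> //; apply: mk_ses => //.
- apply/monoP => Z u ku0; apply: (ses_inj cc).
  by rewrite -g'k -compA ku0 compm0.
- have [Y [p [v [ep cv]]]] := local_lift (ses_epi cc) g.
  have [w [bw _]] := univ Y p v (esym cv).
  by apply: (@epi_of_comp _ _ _ _ _ w); rewrite bw.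
- move=> Z e be0; have [|z c'z] := ses_ker cc (u := g' \oc e).
    by rewrite compA -gb -compA be0 compm0.
  exists Z, (idm Z), z; split; rewrite ?compm1; first exact: epi_idm.
  apply/esym/subr0_eq; have [|a f'a] := ses_ker fg' (u := e - k \oc z).
    by rewrite compmB compA g'k c'z subrr.
  rewrite -f'a (_ : a = 0) ?compm0 //; apply: (ses_inj fg).
  by rewrite -bf' -compA f'a compmB be0 compA bk comp0m subr0.
Qed.

(** The third isomorphism theorem, as the short exact sequence
    B/A -> C/A -> C/B. *)
Lemma noether A B C Q R (f1 : hom A B) (g1 : hom B Q)
    (f2 : hom B C) (g2 : hom C R) : ses f1 g1 -> ses f2 g2 ->
  exists D (h : hom C D) (k : hom Q D) (l : hom D R),
    [/\ ses (f2 \oc f1) h, ses k l, k \oc g1 = h \oc f2 & l \oc h = g2].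
Proof.
move=> s1 s2; have [D [h sh]] : exists D (h : hom C D), ses (f2 \oc f1) h.
  apply: (ses_of_mono hK); apply/monoP => Z u.
  by rewrite -compA => /(ses_inj s2)/(ses_inj s1).
have [|k kg] := ses_coker s1 (u := h \oc f2).
  by rewrite -compA (ses_comp0 sh).
have [|l lh] := ses_coker sh (u := g2).
  by rewrite compA (ses_comp0 s2) comp0m.
exists D, h, k, l; split=> //; apply: mk_ses.
- apply/monoP => Z u ku0.
  have [Y [p [b [ep gb]]]] := local_lift (ses_epi s1) u.
  have [|a fa] := ses_ker sh (u := f2 \oc b).
    by rewrite compA -kg -compA gb compA ku0 comp0m.
  apply: ep; rewrite -gb comp0m (_ : b = f1 \oc a).
    by rewrite compA (ses_comp0 s1) comp0m.
  by apply: (ses_mono s2); rewrite -fa compA.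
- by apply: (@epi_of_comp _ _ _ _ _ h); rewrite lh; exact: ses_epi s2.
- apply: (ses_epi s1); rewrite -compA kg compA lh (ses_comp0 s2).
  by rewrite comp0m.
- move=> Z d ld0; have [Y [p [c [ep hc]]]] := local_lift (ses_epi sh) d.
  have [|b fb] := ses_ker s2 (u := c).
    by rewrite -lh -compA hc compA ld0 comp0m.
  by exists Y, p, (g1 \oc b); split; rewrite // compA kg -hc -compA fb.
Qed.

End Diagrams.

Section DualDiagrams.
Variable K : preadditive.
Hypothesis hK : abelian K.
Let hKop := op_abelian hK.
Implicit Types A B C D P Q X Y Z : K.

Lemma push A B C (f : hom A B) (g : hom B C) A' (a : hom A A') : ses f g ->
  exists E (f' : hom A' E) (g' : hom E C) (b : hom B E),
    [/\ ses f' g', g' \oc b = g & b \oc f = f' \oc a].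
Proof.
move=> fg; have [E [g' [f' [b [/ses_op fg' gb bf _]]]]] :=
  @pull (op K) hKop _ _ _ _ _ _ a (op_ses fg).
by exists E, f', g', b.
Qed.

Lemma push_mono A B C (f : hom A B) (g : hom B C) A' A'' (a : hom A A')
    (a' : hom A' A'') : ses f g -> ses a a' ->
  exists E (f' : hom A' E) (g' : hom E C) (b : hom B E) (b' : hom E A''),
    [/\ ses f' g', ses b b', g' \oc b = g & b' \oc f' = a'].
Proof.
move=> fg aa; have [E [g' [f' [b' [b [/ses_op fg' /ses_op bb gb bf]]]]]] :=
  @pull_epi (op K) hKop _ _ _ _ _ _ _ _ _ (op_ses fg) (op_ses aa).
by exists E, f', g', b, b'.
Qed.

Lemma noether_epi A B C Q R (g1 : hom B A) (f1 : hom Q B)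
    (g2 : hom C B) (f2 : hom R C) : ses f1 g1 -> ses f2 g2 ->
  exists D (h : hom D C) (k : hom D Q) (l : hom R D),
    [/\ ses h (g1 \oc g2), ses l k, f1 \oc k = g2 \oc h & h \oc l = f2].
Proof.
move=> s1 s2; have [D [h [k [l [/ses_op sh /ses_op lk e1 e2]]]]] :=
  @noether (op K) hKop _ _ _ _ _ _ _ _ _ (op_ses s1) (op_ses s2).
by exists D, h, k, l.
Qed.

(** Exactness of Hom(M, B) -> Hom(M, C) -> Ext^1(M, A). *)
Lemma E1_lift A B C M (f : hom A B) (g : hom B C) (u : hom M C) :
  ses f g -> E1 M A -> exists v : hom M B, g \oc v = u.
Proof.
move=> fg MA; have [E [f' [g' [b [fg' _ gb _]]]]] := pull hK u fg.
have [r rf] := MA _ _ _ fg'; have [s [gs _]] := splits_section fg' rf.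
by exists (b \oc s); rewrite compA gb -compA gs compm1.
Qed.

Lemma E1_extend A B C M (f : hom A B) (g : hom B C) (u : hom A M) :
  ses f g -> E1 C M -> exists v : hom B M, v \oc f = u.
Proof.
move=> fg MA; have [E [f' [g' [b [fg' _ bf]]]]] := push u fg.
have [r rf] := MA _ _ _ fg'.
by exists (r \oc b); rewrite -compA bf compA rf comp1m.
Qed.

Lemma E1_projective P B : projective K P -> E1 P B.
Proof.
move=> pP E f g fg; have [s gs] := pP _ _ _ (idm P) (ses_epi fg).
by have [r [rf _]] := splits_retraction fg gs; exists r.
Qed.

Lemma E1_injective A I : injective_obj K I -> E1 A I.
Proof. by move=> iI E f g fg; exact: (iI _ _ _ (idm I) (ses_mono fg)). Qed.

(** In an extension E of [B] by [M], the part over [A] splits; pushing out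
    along the retraction leaves an extension of [C] by [M]. *)
Lemma E1_middle A B C M (f : hom A B) (g : hom B C) :
  ses f g -> E1 A M -> E1 C M -> E1 B M.
Proof.
move=> fg AM CM E u v uv.
have [N [h [k [l [hg lk _ hl]]]]] := noether_epi fg uv.
have [r rl] := AM _ _ _ lk.
have [E' [u' [v' [b [uv' _ bh]]]]] := push r hg.
have [r' r'u] := CM _ _ _ uv'; exists (r' \oc b).
by rewrite -hl -compA (compA b) bh -(compA u') rl compm1.
Qed.

(** Exactness of Hom(B, M) -> Hom(A, M) -> Ext^1(C, M) -> Ext^1(B, M). *)
Lemma E1_right A B C M (f : hom A B) (g : hom B C) : ses f g -> E1 B M ->
  (forall u : hom A M, exists v : hom B M, v \oc f = u) -> E1 C M.
Proof.
move=> fg BM ext E u v uv; have [b vb] := E1_lift g uv BM.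
have [|x ux] := ses_ker uv (u := b \oc f).
  by rewrite compA vb (ses_comp0 fg).
have [y yf] := ext x; have [|s sg] := ses_coker fg (u := b - u \oc y).
  by rewrite compBm -compA yf ux subrr.
have vs : v \oc s = idm C.
  apply: (ses_epi fg); rewrite -compA sg compmB vb compA (ses_comp0 uv).
  by rewrite comp0m subr0 comp1m.
by have [r [ru _]] := splits_retraction uv vs; exists r.
Qed.

(** Exactness of Hom(M, B) -> Hom(M, C) -> Ext^1(M, A) -> Ext^1(M, B). *)
Lemma E1_of_lift A B C M (f : hom A B) (g : hom B C) : ses f g ->
  E1 M B -> (forall u : hom M C, exists v : hom M B, g \oc v = u) -> E1 M A.
Proof.
move=> fg MB lft E u v uv; have [b bu] := E1_extend f uv MB.
have [|x xv] := ses_coker uv (u := g \oc b).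
  by rewrite -compA bu (ses_comp0 fg).
have [y gy] := lft x; have [|r fr] := ses_ker fg (u := b - y \oc v).
  by rewrite compmB compA gy xv subrr.
exists r; apply: (ses_mono fg).
rewrite compA fr compBm bu -compA (ses_comp0 uv) compm0 subr0.
by rewrite compm1.
Qed.

Lemma E1_retract A B H (i : hom B H) (r : hom H B) :
  r \oc i = idm B -> E1 A H -> E1 A B.
Proof.
move=> ri AH E f g fg; have [v vf] := E1_extend i fg AH.
by exists (r \oc v); rewrite -compA vf ri.
Qed.

(** The pushout E of [B] along A -> P is an extension of [C] by [P], hence
    the sum P + C, which embeds into P + Q. *)
Lemma horseshoe A B C (f : hom A B) (g : hom B C) P A' (a : hom A P)
    (a' : hom P A') Q C' (c : hom C Q) (c' : hom Q C') :
  ses f g -> ses a a' -> ses c c' -> E1 C P ->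
  exists R B' (b : hom B R) (b' : hom R B') (f' : hom A' B') (g' : hom B' C'),
    [/\ ses b b', ses f' g' & exists i1 i2 p1 p2,
        @is_biproduct _ P Q R i1 i2 p1 p2].
Proof.
move=> fg aa cc CP.
have [E [f1 [g1 [b [b' [fg1 bb _ _]]]]]] := push_mono fg aa.
have [r rf1] := CP _ _ _ fg1.
have [R [i1 [i2 [p1 [p2 bip]]]]] := has_biproducts hK P Q.
have [pi1 pi2 p12 p21 ipR] := bip.
have [m [p1m p2m]] : exists m : hom E R, p1 \oc m = r /\ p2 \oc m = c \oc g1.
  exists (i1 \oc r + i2 \oc (c \oc g1)).
  rewrite !compDr !compA pi1 pi2 p12 p21 !comp0m !comp1m.
  by rewrite addr0 add0r.
have sm : ses m (c' \oc p2).
  apply: (mk_ses hK).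
  - apply/monoP => Z u mu0; have [|x fx] := ses_ker fg1 (u := u).
      by apply: (ses_inj cc); rewrite compA -p2m -compA mu0 compm0.
    have x0 : x = 0.
      by rewrite -(comp1m x) -rf1 -compA fx -p1m -compA mu0 compm0.
    by rewrite -fx x0 compm0.
  - apply: (@epi_of_comp _ _ _ _ _ i2); rewrite -compA pi2 compm1.
    exact: ses_epi cc.
  - by rewrite -compA p2m compA (ses_comp0 cc) comp0m.
  - move=> Z y; rewrite -compA => /(ses_ker cc)[x cx].
    have [Y [p [e [ep ge]]]] := local_lift hK (ses_epi fg1) x.
    exists Y, p, (e + f1 \oc (p1 \oc (y \oc p) - r \oc e)); split=> //.
    apply: (biproduct_eq bip); rewrite compA ?p1m ?p2m compDr.
      by rewrite (compA r) rf1 comp1m addrC subrK.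
    rewrite -!(compA c) (compA g1 f1) (ses_comp0 fg1) comp0m compm0 addr0.
    by rewrite ge compA cx compA.
have [B' [h [k [l [mh kl _ _]]]]] := noether hK bb sm.
by exists R, B', (m \oc b), h, k, l; split=> //; exists i1, i2, p1, p2.
Qed.

End DualDiagrams.

Section ProjectiveHorseshoe.
Variable K : preadditive.
Hypothesis hK : abelian K.
Let hKop := op_abelian hK.
Implicit Types A B C D P Q X Y Z : K.

Lemma horseshoe_epi A B C (f : hom A B) (g : hom B C) P A' (a' : hom A' P)
    (a : hom P A) Q C' (c' : hom C' Q) (c : hom Q C) :
  ses f g -> ses a' a -> ses c' c -> E1 Q A ->
  exists R B' (b' : hom B' R) (b : hom R B) (f' : hom A' B') (g' : hom B' C'),
    [/\ ses b' b, ses f' g' & exists i1 i2 p1 p2,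
        @is_biproduct _ P Q R i1 i2 p1 p2].
Proof.
move=> fg aa cc /op_E1 CP.
have [R [B' [b [b' [g' [f' [/ses_op sb /ses_op sf bR]]]]]]] :=
  @horseshoe (op K) hKop _ _ _ _ _ _ _ _ _ _ _ _ _ (op_ses fg)
    (op_ses cc) (op_ses aa) CP.
have [i1 [i2 [p1 [p2 bip]]]] := bR.
exists R, B', b', b, f', g'; split=> //; exists p2, p1, i2, i1.
case: bip => h1 h2 h3 h4 h5; split=> //.
by rewrite addrC -[RHS]h5.
Qed.

Lemma biproduct_projective P Q R i1 i2 p1 p2 :
  @is_biproduct _ P Q R i1 i2 p1 p2 ->
  projective K P -> projective K Q -> projective K R.
Proof.
case=> _ _ _ _ ip pP pQ B C g f eg.
have [u gu] := pP _ _ _ (f \oc i1) eg; have [v gv] := pQ _ _ _ (f \oc i2) eg.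
exists (u \oc p1 + v \oc p2).
by rewrite compDr !compA gu gv -!compA -compDr ip compm1.
Qed.

End ProjectiveHorseshoe.

(** * Exactness and resolutions *)

Section Exactness.
Variable K : preadditive.
Hypothesis hK : abelian K.
Implicit Types A B C D M P Q X Y Z : K.

Lemma exact_at0 A B C (f : hom A B) (g : hom B C) :
  exact_at f g -> g \oc f = 0.
Proof. by case=> N [k [e [[gk _] _ ->]]]; rewrite compA gk comp0m. Qed.

Lemma exact_at_lift A B C (f : hom A B) (g : hom B C) Z (b : hom Z B) :
  exact_at f g -> g \oc b = 0 ->
  exists Y (p : hom Y Z) (a : hom Y A), epi p /\ f \oc a = b \oc p.
Proof.
case=> N [k [e [[_ kk] ee ->]]] /kk[v [kv _]].
have [Y [p [a [ep ea]]]] := local_lift hK ee v.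
by exists Y, p, a; rewrite -compA ea compA kv.
Qed.

Lemma exact_at_proj A B C (f : hom A B) (g : hom B C) P (b : hom P B) :
  exact_at f g -> projective K P -> g \oc b = 0 -> exists a, f \oc a = b.
Proof.
case=> N [k [e [[_ kk] ee ->]]] pP /kk[v [kv _]].
by have [a ea] := pP _ _ _ v ee; exists a; rewrite -compA ea.
Qed.

Lemma short_exactP A B C (f : hom A B) (g : hom B C) :
  short_exact f g <-> ses f g.
Proof.
split=> [[mf ex eg] | fg]; last first.
  split; [exact: ses_mono fg | | exact: ses_epi fg].
  exists A, f, (idm A); split; rewrite ?compm1 //; last exact: epi_idm.
  by case: fg.
apply: (mk_ses hK) => //; first exact: exact_at0 ex.
by move=> Z b; apply: exact_at_lift.
Qed.

(** The factorization of [g] through the cokernel of [f] is a monomorphism,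
    because what it kills lifts locally to the kernel of [g], the image of
    [f]. *)
Lemma exact_at_to_op A B C (f : hom A B) (g : hom B C) :
  exact_at f g -> @exact_at (op K) C B A g f.
Proof.
move=> fg; have [Q [q cq]] := has_cokernels hK f.
have [m [mq _]] := cq.2 _ _ (exact_at0 fg).
have eq : epi q by exact: (@kernel_mono (op K) _ _ _ f q cq).
exists Q, q, m; split=> //; change (mono m); apply/monoP => Z u mu0.
have [Y [p [b [ep qb]]]] := local_lift hK eq u.
have [|Y' [p' [a [ep' fa]]]] := exact_at_lift (b := b) fg.
  by rewrite -mq -compA qb compA mu0 comp0m.
apply: (epi_comp ep ep').
by rewrite comp0m compA -qb -compA -fa compA cq.1 comp0m.
Qed.

Lemma left_resolution_shift M (C : nat -> K)
    (d : forall k, hom (C k.+1) (C k)) e :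
  @left_resolution K M C d e ->
  exists N (k : hom N (C 0%N)) (e' : hom (C 1%N) N),
    [/\ ses k e, d 0%N = k \oc e' &
        @left_resolution K N (fun k => C k.+1) (fun k => d k.+1) e'].
Proof.
case=> ee ex exd; have [N [k [e' [kk ee' dk]]]] := ex.
have [N' [k' ke]] := ses_of_epi hK ee.
have [v [kv _]] := kk.2 _ _ (ses_comp0 ke).
have [v' kv'] := ses_ker ke kk.1.
have mk : mono k := kernel_mono kk.
have ske : ses k e.
  apply: (mk_ses hK) => //; first exact: kk.1.
  move=> Z b eb0; have [a ka] := ses_ker ke eb0.
  exists Z, (idm Z), (v \oc a); split; first exact: epi_idm.
  by rewrite compA kv compm1.
exists N, k, e'; split=> //; split=> //.
have [N1 [k1 [e1 [[dk1 kk1] ee1 dke]]]] := exd 0%N.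
exists N1, k1, e1; split=> //; split=> [|Z u e'u0].
  by apply: mk; rewrite compA -dk dk1 compm0.
by apply: kk1; rewrite dk -compA e'u0 compm0.
Qed.

(** Defined by cases on the index, so that the tail is convertible to [C] and
    no transport is needed when resolutions are spliced. *)
Definition scons P (C : nat -> K) (k : nat) : K :=
  if k is k'.+1 then C k' else P.

Definition scons_d N P (i : hom N P) (C : nat -> K)
    (d : forall k, hom (C k.+1) (C k)) (e : hom (C 0%N) N) (k : nat) :
    hom (scons P C k.+1) (scons P C k) :=
  match k with 0%N => i \oc e | k'.+1 => d k' end.

Lemma left_resolution_scons N P M (i : hom N P) (p : hom P M)
    (R : nat -> K) d e :
  ses i p -> @left_resolution K N R d e ->
  @left_resolution K M (scons P R) (scons_d i d e) p.
Proof.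
move=> ip [ee ex exd]; split; first exact: ses_epi ip.
  by exists N, i, e; split=> //; case: ip.
case=> [|k]; last exact: exd k.
have [N' [k' [e' [[ek kk] ee' dk]]]] := ex.
exists N', k', e'; split=> //; split=> [|Z u].
  by rewrite -compA ek compm0.
by rewrite -compA => /(ses_inj ip)/kk.
Qed.

Lemma left_resolution_zero Z : is_zero Z ->
  @left_resolution K Z (fun=> Z) (fun=> idm Z) (idm Z).
Proof.
move=> Z0; have ex : exact_at (idm Z) (idm Z).
  exists Z, (idm Z), (idm Z); split; rewrite ?comp1m //; last exact: epi_idm.
  split=> [|Y u _]; first exact: is_zero_eq.
  by exists u; split=> [|v _]; exact: is_zero_eq.
by split=> //; exact: epi_idm.
Qed.

Lemma left_resolution_triv M Z : is_zero Z ->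
  @left_resolution K M (scons M (fun=> Z))
    (scons_d (0 : hom Z M) (fun=> idm Z) (idm Z)) (idm M).
Proof.
move=> Z0; apply: left_resolution_scons; first exact: ses_zero_l.
exact: left_resolution_zero.
Qed.

End Exactness.

Section ResolutionDimension.
Variable K : preadditive.
Hypothesis hK : abelian K.
Implicit Types A B C D M P Q X Y Z : K.

Definition iso_closed (C : set K) : Prop :=
  forall A B (f : hom A B), iso f -> C A -> C B.

(** A [C]-resolution of length [n], cut into short exact sequences: unlike
    [has_resolution], this form is suited to inductions on [n]. *)
Fixpoint res (C : set K) (n : nat) (M : K) : Prop :=
  if n is n'.+1 then
    exists N P (i : hom N P) (p : hom P M), [/\ ses i p, C P & res C n' N]
  else C M.

Lemma has_resolutionP (C : set K) n M : iso_closed C ->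
  has_resolution C M n <-> res C n M.
Proof.
move=> Ciso; split.
  elim: n M => [|n IHn] M [R [d [e [Rd CR R0]]]].
    have [ee ex _] := Rd; apply: (Ciso _ _ e _ (CR 0%N _)) => //.
    apply: mono_epi_iso => //; apply/monoP => Z u eu0.
    have [Y [p [a [ep da]]]] := exact_at_lift hK ex eu0.
    apply: ep; rewrite comp0m -da (_ : a = 0) ?compm0 //.
    by case: (R0 1%N isT).
  have [N [i [e' [ie _ Rd']]]] := left_resolution_shift hK Rd.
  exists N, (R 0%N), i, e; split; [by [] | exact: CR |].
  apply: IHn; exists (fun k => R k.+1), (fun k => d k.+1), e'.
  by split=> // k kn; [apply: CR | apply: R0].
elim: n M => [|n IHn] M; have [Z Z0] := has_zero hK.
  move=> CM; exists (scons M (fun=> Z)).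
  exists (scons_d (0 : hom Z M) (fun=> idm Z) (idm Z)), (idm M).
  split; first exact: left_resolution_triv.
    by case.
  by case.
move=> [N [P [i [p [ip CP /IHn[R [d [e [Rd CR R0]]]]]]]]].
exists (scons P R), (scons_d i d e), p; split.
- exact: left_resolution_scons.
- by case.
- by case=> // k kn; apply: R0.
Qed.

Lemma res_mono (C D : set K) : (forall M, C M -> D M) ->
  forall n M, res C n M -> res D n M.
Proof.
move=> CD; elim=> [|n IHn] M /=; first exact: CD.
move=> [N [P [i [p [ip CP /IHn DN]]]]].
by exists N, P, i, p; split=> //; exact: CD.
Qed.

Lemma res_leq (C : set K) : (forall Z, is_zero Z -> C Z) ->
  forall m n M, (m <= n)%N -> res C m M -> res C n M.
Proof.
move=> C0; elim=> [|m IHm] [|n] M //=.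
  move=> _ CM; have [Z Z0] := has_zero hK.
  exists Z, M, 0, (idm M); split=> //; first exact: ses_zero_l.
  by elim: n => [|n IHn] /=; [exact: C0|];
     exists Z, Z, 0, (idm Z); split=> //; [exact: ses_zero_l | exact: C0].
rewrite ltnS => mn [N [P [i [p [ip CP Nm]]]]].
by exists N, P, i, p; split=> //; exact: IHm.
Qed.

End ResolutionDimension.

Section Coresolution.
Variable K : preadditive.
Hypothesis hK : abelian K.

Lemma has_coresolution_op (C : set K) M n :
  has_coresolution C M n <-> @has_resolution (op K) C M n.
Proof.
split=> -[R [d [e [[me ex exd] CR R0]]]]; exists R, d, e; split=> //.
- split=> //; first exact: exact_at_to_op.
  by move=> k; exact: exact_at_to_op.
- by move=> k kn; apply/op_zero/R0.
- split=> //; first exact: (@exact_at_to_op (op K) (op_abelian hK)).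
  by move=> k; exact: (@exact_at_to_op (op K) (op_abelian hK)).
- by move=> k kn; apply/op_zero/R0.
Qed.

End Coresolution.

(** * Consequences of the vanishing of Yoneda Ext *)

Section YonedaExt.
Variable K : preadditive.
Hypothesis hK : abelian K.
Implicit Types A B C D M P Q X Y Z : K.

Let equiv n A B := clos_refl_sym_trans _ (@ext_morphism K n A B).

Lemma Ext_vanish_equiv n A B (E E' : extension n A B) :
  Ext_vanish n A B -> equiv E E'.
Proof.
move=> H; have EE' := H _ _ (imageT _ E) (imageT _ E').
suff: [set F | equiv E F] E' by [].
by rewrite EE'; exact: rst_refl.
Qed.

Lemma Ext_vanish_invariant n A B (T : extension n A B -> Prop) E E' :
  Ext_vanish n A B ->
  (forall F F', ext_morphism F F' -> T F <-> T F') -> T E -> T E'.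
Proof.
move=> /(Ext_vanish_equiv E E') EE' Tinv; suff: T E <-> T E' by case.
elim: EE' => [F F' /Tinv||F F' _ []|F F' F'' _ [? ?] _ [? ?]] //.
by split; auto.
Qed.

Lemma ext1_of_ses A B D (i : hom B D) (p : hom D A) : ses i p ->
  exists E : extension 1 A B,
    (exists s, ext_aug E \oc s = idm A) <-> (exists s, p \oc s = idm A).
Proof.
move=> ip; have [Z Z0] := has_zero hK.
have R := left_resolution_scons ip (left_resolution_triv B Z0).
have iB : iso (idm B) by exists (idm B); rewrite comp1m.
unshelve eexists.
  by refine (@Extension _ 1 A B _ _ p (idm B) R iB _); case=> [|[|k]].
by [].
Qed.

Lemma ses_of_ext1 A B (E : extension 1 A B) :
  ses (ext_d E 0%N \oc ext_end E) (ext_aug E).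
Proof.
have [ee ex exd] := ext_exact E; have [g [ge eg]] := ext_iso E.
have md : mono (ext_d E 0%N).
  apply/monoP => Z u du0.
  have [Y [p [a [ep da]]]] := exact_at_lift hK (exd 0%N) du0.
  apply: ep; rewrite comp0m -da (_ : a = 0) ?compm0 //.
  by case: (@ext_bound _ _ _ _ E 2%N isT).
apply: (mk_ses hK) => //.
- apply/monoP => Z u; rewrite -compA => /(iffLR (monoP _) md) eu0.
  by rewrite -(comp1m u) -ge -compA eu0 compm0.
- by rewrite compA (exact_at0 ex) comp0m.
- move=> Z b eb0; have [Y [p [a [ep da]]]] := exact_at_lift hK ex eb0.
  exists Y, p, (g \oc a); split=> //.
  by rewrite -compA (compA _ g) eg comp1m.
Qed.

(** The existence of a section is invariant under morphisms of extensions, and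
    holds for the biproduct. *)
Lemma Ext_vanish_E1 A B : Ext_vanish 1 A B -> E1 A B.
Proof.
move=> AB D i p ip; have [E splitE] := ext1_of_ses ip.
have [S [i1 [i2 [p1 [p2 [pi1 pi2 p12 p21 ipS]]]]]] := has_biproducts hK A B.
have sS : ses i2 p1.
  apply: (mk_ses hK) => //.
  - by apply/monoP => Y v iv0; rewrite -(comp1m v) -pi2 -compA iv0 compm0.
  - by apply: (@epi_of_comp _ _ _ _ _ i1); rewrite pi1; exact: epi_idm.
  - move=> Y b pb0; exists Y, (idm Y), (p2 \oc b); split; first exact: epi_idm.
    by rewrite compm1 -[RHS]comp1m -ipS compDl -!compA pb0 compm0 add0r.
have [E' splitE'] := ext1_of_ses sS.
have [s ps] : exists s, p \oc s = idm A.
  apply/splitE; apply: (@Ext_vanish_invariant _ _ _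
    (fun E => exists s, ext_aug E \oc s = idm A) E' E AB) => [F F'|].
    move=> [f [fd fa fe]]; split=> -[s es].
      by exists (f 0%N \oc s); rewrite compA fa.
    (* Retractions, unlike sections, pull back along morphisms. *)
    have [r [rd _]] := splits_retraction (ses_of_ext1 F') es.
    have [|s' [es' _]] := splits_section (ses_of_ext1 F) (r := r \oc f 0%N).
      by rewrite -compA (compA (f 0%N)) fd -(compA _ (f 1%N)) fe.
    by exists s'.
  by apply/splitE'; exists i1.
by have [r [ri _]] := splits_retraction ip ps; exists r.
Qed.

End YonedaExt.

(** * Gorenstein objects without complexes *)

Section TwoSided.
Variable K : preadditive.
Implicit Types (CX CY CZ CW S : set K) (G X Y Z : K).

(** The coinductive form of being a cycle of an exact complex over [CX]: the
    members of [S] can be continued in both directions within [S]. *)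
Definition twosided CX S : Prop := forall G, S G ->
  (exists X G' (f : hom G X) (g : hom X G'), [/\ ses f g, CX X & S G']) /\
  (exists X G' (f : hom G' X) (g : hom X G), [/\ ses f g, CX X & S G']).

Lemma twosided_chain CX S G : twosided CX S -> S G ->
  exists (X Z : int -> K) (i : forall m, hom (Z (m + 1)) (X m))
    (q : forall m, hom (X m) (Z m)),
    [/\ forall m, ses (i m) (q m), forall m, CX (X m), forall m, S (Z m) &
        Z 0 = G].
Proof.
move=> twoS SG; pose T := {G | S G}.
pose link (x y : T) := exists X (f : hom (sval x) X) (g : hom X (sval y)),
  ses f g /\ CX X.
have /boolp.choice[sc scP] : forall x, exists y, link x y.
  case=> H SH; have [[X [G' [f [g [fg CXX SG']]]]] _] := twoS H SH.
  by exists (exist _ G' SG'), X, f, g.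
have /boolp.choice[pr prP] : forall x, exists y, link y x.
  case=> H SH; have [_ [X [G' [f [g [fg CXX SG']]]]]] := twoS H SH.
  by exists (exist _ G' SG'), X, f, g.
pose x0 : T := exist _ G SG.
pose z (m : int) :=
  match m with Posz n => iter n pr x0 | Negz n => iter n.+1 sc x0 end.
(* As a relation, a link can be rewritten along equations between indices. *)
have zP m : link (z (m + 1)) (z m).
  case: m => [n|[|n]].
  - by have -> : Posz n + 1 = Posz n.+1; [rewrite intS addrC | exact: prP].
  - exact: scP.
  - have -> : Negz n.+1 + 1 = Negz n; last exact: scP.
    by rewrite !NegzE (intS n.+1) opprD addrAC addNr add0r.
pose D m := cid (zP m); pose X m : K := sval (D m).
pose Di m := cid (svalP (D m)); pose Dq m := cid (svalP (Di m)).
exists X, (fun m => sval (z m)), (fun m => sval (Di m)), (fun m => sval (Dq m)).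
split=> // m; last exact: svalP.
  by case: (svalP (Dq m)).
by case: (svalP (Dq m)).
Qed.

Lemma complex_of_chain (X Z : int -> K) (i : forall m, hom (Z (m + 1)) (X m))
    (q : forall m, hom (X m) (Z m))
    (d := fun m : int => @comp K _ _ _ (i m) (q (m + 1))) :
  (forall m, ses (i m) (q m)) ->
  exact_complex d /\ forall m, is_kernel (d m) (i (m + 1)).
Proof.
move=> iq; have ker m : is_kernel (d m) (i (m + 1)).
  split=> [|Y u]; first by rewrite -compA (ses_comp0 (iq _)) compm0.
  by rewrite -compA => /(ses_inj (iq m)); case: (iq (m + 1)) => -[_ h] _ /h.
split=> // m; exists (Z (m + 1 + 1)), (i (m + 1)), (q (m + 1 + 1)).
by split=> //; exact: ses_epi (iq _).
Qed.

Lemma cycle_of_chain (X Z : int -> K) (i : forall m, hom (Z (m + 1)) (X m))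
    (q : forall m, hom (X m) (Z m)) :
  (forall m, ses (i m) (q m)) ->
  @is_cycle K X (fun m : int => @comp K _ _ _ (i m) (q (m + 1))) (Z 0).
Proof.
move=> iq; have [_ ker] := complex_of_chain iq.
have [m m0] : exists m : int, m + 1 + 1 = 0.
  by exists (- 1 - 1); rewrite subrK addNr.
by rewrite -m0; exists m, (i (m + 1)).
Qed.

Lemma kernel_unique (A B N N' : K) (f : hom A B) (k : hom N A) (k' : hom N' A) :
  is_kernel f k -> is_kernel f k' -> exists u, iso u /\ k' \oc u = k.
Proof.
move=> [fk kk] [fk' kk']; have [u [k'u u_uniq]] := kk' _ _ fk.
have [v [kv v_uniq]] := kk _ _ fk'; exists u; split=> //; exists v; split.
  have [w [_ w_uniq]] := kk _ _ fk.
  by rewrite -(w_uniq (idm N)) ?compm1 // -(w_uniq (v \oc u)) // compA kv.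
have [w [_ w_uniq]] := kk' _ _ fk'.
by rewrite -(w_uniq (idm N')) ?compm1 // -(w_uniq (u \oc v)) // compA k'u.
Qed.

End TwoSided.

Section Cycles.
Variable K : preadditive.
Hypothesis hK : abelian K.
Variables (X : int -> K) (d : forall m, hom (X (m + 1)) (X m)).
Hypothesis ex : exact_complex d.

Lemma cycle_ses m (G G' : K) (i : hom G (X (m + 1)))
    (j : hom G' (X (m + 1 + 1))) :
  is_kernel (d m) i -> is_kernel (d (m + 1)) j ->
  exists e, ses j e /\ d (m + 1) = i \oc e.
Proof.
move=> ki kj; have [N [k [e [kk ee dke]]]] := ex m.
have [u [[v [vu uv]] iu]] := kernel_unique kk ki.
have mi := kernel_mono ki.
have di : d (m + 1) = i \oc (u \oc e) by rewrite compA iu.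
have ji : (u \oc e) \oc j = 0 by apply: mi; rewrite compA -di kj.1 compm0.
exists (u \oc e); split=> //; apply: (mk_ses hK) => //.
- exact: kernel_mono kj.
- apply: epi_comp ee => Y a b ab.
  by rewrite -(compm1 a) -(compm1 b) -uv !compA ab.
- move=> Y b eb0; have [|a [ja _]] := kj.2 _ b.
    by rewrite di -compA eb0 compm0.
  by exists Y, (idm Y), a; rewrite compm1; split=> //; exact: epi_idm.
Qed.

Definition cycles (G : K) : Prop := is_cycle d G.

Lemma cycles_succ G m (i : hom G (X (m + 1))) : is_kernel (d m) i ->
  exists G' (j : hom G' (X (m + 1 + 1))) e,
    [/\ is_kernel (d (m + 1)) j, ses j e & d (m + 1) = i \oc e].
Proof.
move=> ki; have [G' [j kj]] := has_kernels hK (d (m + 1)).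
by have [e [je de]] := cycle_ses ki kj; exists G', j, e.
Qed.

Lemma cycles_pred G : cycles G ->
  exists m (i : hom G (X (m + 1 + 1))) G' (j : hom G' (X (m + 1))) e,
    [/\ is_kernel (d (m + 1)) i, is_kernel (d m) j, ses i e &
        d (m + 1) = j \oc e].
Proof.
case=> n; have [m ->] : exists m, n = m + 1 by exists (n - 1); rewrite subrK.
case=> i ki; have [G' [j kj]] := has_kernels hK (d m).
by have [e [ie de]] := cycle_ses kj ki; exists m, i, G', j, e.
Qed.

Lemma twosided_cycles CX : (forall m, CX (X m)) -> twosided CX cycles.
Proof.
move=> CXX G cG; split.
  have [m [i [G' [j [e [ki kj ie _]]]]]] := cycles_pred cG.
  by exists (X (m + 1 + 1)), G', i, e; split=> //; exists m, j.
have [m [i /cycles_succ[G' [j [e [kj je _]]]]]] := cG.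
by exists (X (m + 1 + 1)), G', j, e; split=> //; exists (m + 1), j.
Qed.

End Cycles.

Section GorensteinClass.
Variable K : preadditive.
Hypothesis hK : abelian K.
Implicit Types (CX CY CZ CW S : set K) (G X Y Z : K).

(** The members of GP without complexes. The last condition stands for the
    exactness of Hom into [CY], provided that Ext^1 from [CX] to [CY]
    vanishes. *)
Definition gorenstein CX CY G : Prop := exists S,
  [/\ twosided CX S, S G & forall H Y, S H -> CY Y -> E1 H Y].

(** If Ext^1(X, Y) = 0 for the terms X of the complex, then all maps from one
    of its cycles to Y extend to the next term if and only if Ext^1 from the
    next cycle to Y vanishes; and these extensions are what the exactness of
    Hom(-, Y) amounts to. *)
Lemma GP_gorenstein CX CY : (forall X Y, CX X -> CY Y -> E1 X Y) ->
  GP CX CY = gorenstein CX CY.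
Proof.
move=> XY; apply/seteqP; split=> G.
  move=> [X [d [ex CXX homY cG]]]; exists (cycles d); split=> //.
    exact: twosided_cycles.
  move=> H Y [m [i ki]] CYY.
  have [H' [j [e [kj je de]]]] := cycles_succ hK ex ki.
  have [H'' [j' [e' [kj' je' de']]]] := cycles_succ hK ex kj.
  apply: (E1_right hK je) => [|v]; first exact: XY.
  have ed0 : e' \oc d (m + 1 + 1 + 1) = 0.
    apply: (kernel_mono kj).
    by rewrite compA -de' (exact_at0 (ex (m + 1 + 1))) compm0.
  have : (range (fun u => u \oc d (m + 1 + 1))) (v \oc e').
    by rewrite (homY Y CYY (m + 1 + 1)) /= -compA ed0 compm0.
  case=> w _ wd; exists w; apply: (ses_epi je').
  by rewrite -compA -de'.
move=> [S [twoS SG SY]].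
have [X [Z [i [q [iq CXX SZ <-]]]]] := twosided_chain twoS SG.
have [ex ker] := complex_of_chain iq.
exists X, (fun m : int => @comp K _ _ _ (i m) (q (m + 1))).
split=> //; last exact: cycle_of_chain.
move=> Y CYY m; apply/seteqP; split=> [_ [u _ <-] | u] /=.
  by rewrite -compA (exact_at0 (ex m)) compm0.
rewrite compA => uiq.
have [v vq] := ses_coker (iq (m + 1)) (ses_surj (iq (m + 1 + 1)) uiq).
have [w wi] := E1_extend hK v (iq m) (SY _ _ (SZ m) CYY).
by exists w; rewrite // compA wi.
Qed.

Lemma twosided_op CX S : twosided CX S -> @twosided (op K) CX S.
Proof.
move=> H G SG; have [h1 h2] := H G SG.
split.
  have [X [G' [f [g [fg CXX SG']]]]] := h2; exists X, G', g, f.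
  by split=> //; exact: op_ses.
have [X [G' [f [g [fg CXX SG']]]]] := h1; exists X, G', g, f.
by split=> //; exact: op_ses.
Qed.

Lemma op_twosided CX S : @twosided (op K) CX S -> twosided CX S.
Proof.
move=> H G SG; have [h1 h2] := H G SG.
split.
  by have [X [G' [f [g [/ses_op fg CXX SG']]]]] := h2; exists X, G', g, f.
by have [X [G' [f [g [/ses_op fg CXX SG']]]]] := h1; exists X, G', g, f.
Qed.

Lemma cycle_iso (X : int -> K) d A B (f : hom A B) :
  iso f -> @is_cycle K X d A -> is_cycle d B.
Proof.
move=> [g [gf fg]] [m [i [di ki]]]; exists m, (i \oc g); split.
  by rewrite compA di comp0m.
move=> Z u du0; have [v [iv v_uniq]] := ki Z u du0; exists (f \oc v); split.
  by rewrite -compA (compA g) gf comp1m.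
move=> w; rewrite -compA => /v_uniq ->.
by rewrite compA fg comp1m.
Qed.

Lemma GP_iso CX CY : iso_closed (GP CX CY).
Proof.
move=> A B f isof [X [d [ex CXX homY cA]]]; exists X, d; split=> //.
exact: cycle_iso isof cA.
Qed.

Lemma GI_iso CZ CW : iso_closed (GI CZ CW).
Proof.
move=> A B f isof [X [d [ex CXX homZ cA]]]; exists X, d; split=> //.
exact: cycle_iso isof cA.
Qed.

End GorensteinClass.

Section GorensteinInjective.
Variable K : preadditive.
Hypothesis hK : abelian K.
Implicit Types (CX CY CZ CW S : set K) (G X Y Z : K).

Lemma GI_gorenstein CZ CW : (forall Z W, CZ Z -> CW W -> E1 Z W) ->
  GI CZ CW = @gorenstein (op K) CW CZ.
Proof.
move=> ZW; apply/seteqP; split=> G.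
  move=> [X [d [ex CXX homZ cG]]]; exists (cycles d); split=> //.
    by apply: twosided_op; exact: twosided_cycles.
  move=> H Z cH CZZ; apply/op_E1; move: H cH Z CZZ; change
    (forall H : K, cycles d H -> forall Z : K, CZ Z -> E1 Z H) => H cH Z CZZ.
  have [m [i [H' [j [e [ki kj ie de]]]]]] := cycles_pred hK ex cH.
  apply: (E1_of_lift hK ie) => [|v]; first exact: ZW.
  have : (range (fun u => d (m + 1) \oc u)) (j \oc v).
    by rewrite (homZ Z CZZ m) /= compA kj.1 comp0m.
  case=> u _ du; exists u; apply: (kernel_mono kj).
  by rewrite compA -de.
move=> [S [/op_twosided twoS SG SZ]].
have [X [T [i [q [iq CXX ST <-]]]]] := twosided_chain twoS SG.
have [ex ker] := complex_of_chain iq.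
exists X, (fun m : int => @comp K _ _ _ (i m) (q (m + 1))).
split=> //; last exact: cycle_of_chain.
move=> Z CZZ m; apply/seteqP; split=> [_ [u _ <-] | u] /=.
  by rewrite compA (exact_at0 (ex m)) comp0m.
rewrite -compA => iqu.
have [v iv] := ses_ker (iq (m + 1)) (ses_inj (iq m) iqu).
have TZ : E1 Z (T (m + 1 + 1 + 1)) by apply/op_E1; exact: SZ.
have [w qw] := E1_lift hK v (iq (m + 1 + 1)) TZ.
by exists w; rewrite // -compA qw.
Qed.

End GorensteinInjective.

(** * Approximation by objects of finite projective dimension *)

Section Coresolved.
Variable K : preadditive.
Hypothesis hK : abelian K.
Variable V : set K.
Implicit Types A B C G H M P Q X Y Z : K.

Hypothesis V_ext : forall A B C (f : hom A B) (g : hom B C),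
  ses f g -> V A -> V C -> V B.
Hypothesis V_E1 : forall G Q, V G -> projective K Q -> E1 G Q.

(** One step of a coresolution by projectives with cosyzygies in [S] that
    stays in [V]; [cores] is the greatest class closed under such steps. *)
Definition cores_step (S : set K) G : Prop :=
  V G /\ exists P G' (f : hom G P) (g : hom P G'),
    [/\ ses f g, projective K P & S G'].

Definition cores G : Prop := exists S : set K,
  S G /\ forall H, S H -> cores_step S H.

Lemma coresP G : cores G -> cores_step cores G.
Proof.
move=> [S [SG SS]]; have [VG [P [G' [f [g [fg pP SG']]]]]] := SS G SG.
by split=> //; exists P, G', f, g; split=> //; exists S.
Qed.

Lemma coresI M P G (f : hom M P) (g : hom P G) :
  ses f g -> projective K P -> V M -> cores G -> cores M.
Proof.
move=> fg pP VM cG; exists [set N | N = M \/ cores N].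
split=> [|N [->|/coresP[VN [P' [G' [f' [g' [fg' pP' cG']]]]]]]]; first by left.
  by split=> //; exists P, G, f, g; split=> //; right.
by split=> //; exists P', G', f', g'; split=> //; right.
Qed.

Lemma cores_ext A B C (f : hom A B) (g : hom B C) :
  ses f g -> cores A -> cores C -> cores B.
Proof.
move=> fg cA cC.
exists [set B | exists A C (f : hom A B) (g : hom B C),
  [/\ ses f g, cores A & cores C]].
split=> [|{A B C f g fg cA cC} B [A [C [f [g [fg cA cC]]]]]].
  by exists A, C, f, g.
have [VA [P [A' [a [a' [aa pP cA']]]]]] := coresP cA.
have [VC [Q [C' [c [c' [cc pQ cC']]]]]] := coresP cC.
split; first exact: V_ext fg VA VC.
have [R [B' [b [b' [f' [g' [bb fg' [i1 [i2 [p1 [p2 bip]]]]]]]]]]] :=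
  horseshoe hK fg aa cc (V_E1 VC pP).
exists R, B', b, b'; split=> //; last by exists A', C', f', g'.
exact: biproduct_projective bip pP pQ.
Qed.

(** The Auslander-Buchweitz embedding. From 0 -> N -> G -> M -> 0 and an
    embedding of [N] into H, the pushout E is an extension of a member of
    [cores] by [G], hence embeds into a projective P, and [M] = E/H embeds into
    P/H. *)
Lemma cores_embedding n M : res cores n M ->
  exists H G (f : hom M H) (g : hom H G),
    [/\ ses f g, res (projective K) n H & cores G].
Proof.
elim: n M => [|n IHn] M.
  by move=> /coresP[_ [P [G' [f [g [fg pP cG']]]]]]; exists P, G', f, g.
move=> [N [G [i [p [ip cG /IHn[H [G' [f [g [fg Hn cG']]]]]]]]]].
have [E [f' [g' [b [b' [fg' bb _ _]]]]]] := push_mono hK ip fg.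
have [_ [P [G'' [c [c' [cc pP cG'']]]]]] := coresP (cores_ext bb cG cG').
have [M' [h [k [l [Eh kl _ _]]]]] := noether hK fg' cc.
by exists M', G'', k, l; split=> //; exists H, P, (c \oc f'), h.
Qed.

End Coresolved.

(** * Enough projectives *)

Section Covers.
Variable K : preadditive.
Hypothesis hK : abelian K.
Implicit Types A B C G H J M P Q X Y Z : K.

(** The existence of the [n] terms next to [M] in a projective resolution. *)
Fixpoint presented (n : nat) M : Prop :=
  if n is n'.+1 then
    exists N P (i : hom N P) (p : hom P M),
      [/\ ses i p, projective K P & presented n' N]
  else True.

Lemma presentedS n M : presented n.+1 M -> presented n M.
Proof.
elim: n M => // n IHn M [N [P [i [p [ip pP /IHn Nn]]]]].
by exists N, P, i, p.
Qed.

Lemma presented_ext n A B C (f : hom A B) (g : hom B C) :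
  ses f g -> presented n A -> presented n C -> presented n B.
Proof.
elim: n A B C f g => // n IHn A B C f g fg.
move=> [A' [P [a' [a [aa pP An]]]]] [C' [Q [c' [c [cc pQ Cn]]]]].
have [R [B' [b' [b [f' [g' [bb fg' [i1 [i2 [p1 [p2 bip]]]]]]]]]]] :=
  horseshoe_epi hK fg aa cc (E1_projective (B := A) pQ).
exists B', R, b', b; split=> //; last exact: IHn fg' An Cn.
exact: biproduct_projective bip pP pQ.
Qed.

Lemma retract_epi A H (i : hom A H) (r : hom H A) : r \oc i = idm A -> epi r.
Proof.
by move=> ri; apply/epiP => Z u iu0; rewrite -(compm1 u) -ri compA iu0 comp0m.
Qed.

(** If J is a complement of [A] in [H] and P -> [H] a cover with kernel N, then
    the kernel of P -> [A] is an extension of J by N, and J is a retract of [H]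
    as well. *)
Lemma presented_retract n A H (i : hom A H) (r : hom H A) :
  r \oc i = idm A -> presented n H -> presented n A.
Proof.
elim: n A i r => // n IHn A i r ri Hn.
have [J [k kr]] := ses_of_epi hK (retract_epi ri).
have [s [sk _]] := splits_retraction kr ri.
have Jn := IHn J k s sk (presentedS Hn).
have [N [P [i' [p [ip pP Nn]]]]] := Hn.
have [D [h [k' [l [hrp lk _ _]]]]] := noether_epi hK kr ip.
exists D, P, h, (r \oc p); split=> //.
exact: presented_ext lk Nn Jn.
Qed.

(** The pullback of [B] -> [C] along a projective cover P of [C] is both an
    extension of [B] by the syzygy of [C] and the sum of [A] and P. *)
Lemma presented_kernel n A B C (f : hom A B) (g : hom B C) :
  ses f g -> presented n B -> presented n.+1 C -> presented n A.
Proof.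
move=> fg Bn [N [P [i [p [ip pP Nn]]]]].
have [D [f' [g' [k [b [fg' kb _ _]]]]]] := pull_epi hK fg ip.
have [r rf'] := E1_projective (B := A) pP fg'.
exact: presented_retract rf' (presented_ext kb Nn Bn).
Qed.

Lemma presented_projective n P : projective K P -> presented n P.
Proof.
have [Z Z0] := has_zero hK; have pZ := zero_projective Z0.
have Zn : forall n, presented n Z.
  elim=> // m IHm; exists Z, Z, 0, (idm Z).
  by split=> //; exact: ses_zero_l.
case: n => // n pP; exists Z, P, 0, (idm P).
by split=> //; exact: ses_zero_l.
Qed.

Lemma presented_res m n M : res (projective K) m M -> presented n M.
Proof.
elim: m n M => [|m IHm] n M; first exact: presented_projective.
case: n => // n [N [P [i [p [ip pP Nm]]]]].
by exists N, P, i, p; split=> //; exact: IHm.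
Qed.

Definition enough_projectives : Prop :=
  forall M, exists N P (i : hom N P) (p : hom P M),
  ses i p /\ projective K P.

(** Injectives are retracts of objects of finite projective dimension, hence
    presented; objects of finite injective dimension are obtained from them by
    kernels of epimorphisms, and every object is a quotient of such a one. *)
Lemma enough_projectivesP :
  (forall M, exists n H (f : hom M H), mono f /\ res (projective K) n H) ->
  (forall M, exists n (H : K) (f : hom H M),
      epi f /\ @res (op K) (projective (op K)) n H) ->
  enough_projectives.
Proof.
move=> emb quo; have inj n I : injective_obj K I -> presented n I.
  move=> iI; have [m [H [f [mf Hm]]]] := emb I.
  have [r rf] := iI _ _ f (idm I) mf.
  exact: presented_retract rf (presented_res n Hm).
have injdim m n M : @res (op K) (projective (op K)) m M -> presented n M.
  elim: m n M => [|m IHm] n M; first by move=> /op_injective/inj.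
  move=> [N [I [i [p [/ses_op ip /op_injective iI Nm]]]]].
  exact: presented_kernel ip (inj _ _ iI) (IHm _ _ Nm).
move=> M; have [n [H [f [ef Hn]]]] := quo M.
have [N [P [i [p [ip pP _]]]]] := injdim _ 1%N _ Hn.
have [D [h hfp]] := ses_of_epi hK (epi_comp ef (ses_epi ip)).
by exists D, P, h, (f \oc p).
Qed.

End Covers.

(** * Higher Ext by dimension shifting *)

Section HigherExt.
Variable K : preadditive.
Hypothesis hK : abelian K.
Implicit Types A B C G H I J L M P Q X Y Z : K.

Definition enough_injectives : Prop :=
  forall M, exists I L (i : hom M I) (p : hom I L),
  ses i p /\ injective_obj K I.

(** Vanishing of Ext^(n+1)(A, B), by dimension shifting in [B]. Asking for all
    cosyzygies spares a comparison of the choices. *)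
Fixpoint ExtI n A B : Prop :=
  if n is n'.+1 then
    forall I L (i : hom B I) (p : hom I L),
      ses i p -> injective_obj K I -> ExtI n' A L
  else E1 A B.

(** Vanishing of Ext^(n+1)(A, B), by dimension shifting in [A]. *)
Fixpoint ExtP n A B : Prop :=
  if n is n'.+1 then
    forall N P (i : hom N P) (p : hom P A),
      ses i p -> projective K P -> ExtP n' N B
  else E1 A B.

Lemma ExtI_middle n A B C M (f : hom A B) (g : hom B C) : ses f g ->
  ExtI n A M -> ExtI n C M -> ExtI n B M.
Proof.
move=> fg; elim: n M => [|n IHn] M /=; first exact: (E1_middle hK fg).
by move=> AM CM I L i p ip iI; apply: IHn; [exact: AM ip iI | exact: CM ip iI].
Qed.

(** Exactness of Ext^(n+1)(A, M) -> Ext^(n+2)(C, M) -> Ext^(n+2)(B, M). *)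
Lemma ExtI_right n A B C M (f : hom A B) (g : hom B C) : ses f g ->
  ExtI n A M -> ExtI n.+1 B M -> ExtI n.+1 C M.
Proof.
move=> fg; elim: n M => [|n IHn] M; last first.
  move=> AM BM I L i p ip iI.
  by apply: IHn; [exact: AM ip iI | exact: BM ip iI].
move=> /= AM BM I L i p ip iI; apply: (E1_right hK fg); first exact: BM ip iI.
move=> u; have [v pv] := E1_lift hK u ip AM.
have [w wf] := iI _ _ f v (ses_mono fg).
by exists (p \oc w); rewrite -compA wf.
Qed.

Lemma E1_cosyzygy A B I L (i : hom B I) (p : hom I L) :
  ses i p -> injective_obj K I ->
  E1 A B <-> forall u : hom A L, exists v : hom A I, p \oc v = u.
Proof.
move=> ip iI; split=> [AB u | lft]; first exact: (E1_lift hK u ip AB).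
by apply: (E1_of_lift hK ip) => //; exact: E1_injective.
Qed.

Lemma E1_syzygy A B N P (i : hom N P) (p : hom P A) :
  ses i p -> projective K P ->
  E1 A B <-> forall u : hom N B, exists v : hom P B, v \oc i = u.
Proof.
move=> ip pP; split=> [AB u | ext]; first exact: (E1_extend hK u ip AB).
by apply: (E1_right hK ip) => //; exact: E1_projective.
Qed.

Lemma ExtP_injective n A I : injective_obj K I -> ExtP n A I.
Proof.
move=> iI; elim: n A => [|n IHn] A /=; first exact: E1_injective.
by move=> *; exact: IHn.
Qed.

Lemma ExtI_projective n P B : projective K P -> ExtI n P B.
Proof.
move=> pP; elim: n B => [|n IHn] B /=; first exact: E1_projective.
by move=> *; exact: IHn.
Qed.

Lemma ExtP_retract n A B H (i : hom B H) (r : hom H B) :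
  r \oc i = idm B -> ExtP n A H -> ExtP n A B.
Proof.
move=> ri; elim: n A => [|n IHn] A /=; first exact: (E1_retract hK ri).
by move=> AH N P j p jp pP; apply: IHn; exact: AH jp pP.
Qed.

Hypotheses (eP : enough_projectives K) (eI : enough_injectives).

(** Exactness of Ext^(n+1)(B, M) -> Ext^(n+1)(A, M) -> Ext^(n+2)(C, M). *)
Lemma ExtI_left n A B C M (f : hom A B) (g : hom B C) : ses f g ->
  ExtI n B M -> ExtI n.+1 C M -> ExtI n A M.
Proof.
move=> fg; elim: n M => [|n IHn] M; last first.
  move=> BM CM I L i p ip iI.
  by apply: IHn; [exact: BM ip iI | exact: CM ip iI].
move=> BM CM; have [I [L [i [p [ip iI]]]]] := eI M.
apply/(E1_cosyzygy _ ip iI) => u.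
have [v vf] := E1_extend hK u fg (CM _ _ _ _ ip iI).
have [w pw] := E1_lift hK v ip BM.
by exists (w \oc f); rewrite compA pw.
Qed.

(** Both conditions say that every map N -> L, from the syzygy of [A] to the
    cosyzygy of [B], factors as N -> P -> I -> L: as [P] is projective and [I]
    injective, it does so as soon as it factors through one of them. *)
Lemma ExtI1P1 A B : ExtI 1 A B <-> ExtP 1 A B.
Proof.
split=> /= AB.
  move=> N P j q jq pP; have [I [L [i [p [ip iI]]]]] := eI B.
  apply/(E1_cosyzygy _ ip iI) => u.
  have [v vj] := iffLR (E1_syzygy _ jq pP) (AB _ _ _ _ ip iI) u.
  have [w pw] := pP _ _ _ v (ses_epi ip).
  by exists (w \oc j); rewrite compA pw.
move=> I L i p ip iI; have [N [P [j [q [jq pP]]]]] := eP A.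
apply/(E1_syzygy _ jq pP) => u.
have [v pv] := iffLR (E1_cosyzygy _ ip iI) (AB _ _ _ _ jq pP) u.
have [w wj] := iI _ _ _ v (ses_mono jq).
by exists (p \oc w); rewrite -compA wj.
Qed.

Lemma ExtIP n A B : ExtI n A B <-> ExtP n A B.
Proof.
elim/ltn_ind: n A B => -[|[|n]] IH A B //; first exact: ExtI1P1.
split=> AB.
  move=> N P j q jq pP; apply/(IH n.+1) => // I L i p ip iI.
  apply/(IH n) => //; move: N P j q jq pP.
  by apply/(IH n.+1) => //; exact: AB ip iI.
move=> I L i p ip iI; apply/(IH n.+1) => // N P j q jq pP.
apply/(IH n) => //; move: I L i p ip iI.
by apply/(IH n.+1) => //; exact: AB jq pP.
Qed.

End HigherExt.

Section ExtDual.
Variable K : preadditive.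
Hypothesis hK : abelian K.
Implicit Types A B C G H I J L M P Q X Y Z : K.

Lemma op_ExtI n A B : @ExtI (op K) n B A <-> ExtP n A B.
Proof.
elim: n A B => [|n IHn] A B /=; first exact: op_E1.
split=> AB.
  move=> N P i p ip pP.
  by apply/IHn/(AB P N p i (op_ses ip)); exact/op_projective.
by move=> P N p i /ses_op ip /op_projective pP; apply/IHn; exact: AB ip pP.
Qed.

(** Exactness of Ext^(n+1)(M, C) -> Ext^(n+2)(M, A) -> Ext^(n+2)(M, B). *)
Lemma ExtP_shift n A B C M (f : hom A B) (g : hom B C) : ses f g ->
  ExtP n M C -> ExtP n.+1 M B -> ExtP n.+1 M A.
Proof.
move=> fg /op_ExtI MC /op_ExtI MB; apply/op_ExtI.
exact: (ExtI_right (op_abelian hK) (op_ses fg)) MC MB.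
Qed.

Lemma op_enough_injectives : enough_projectives (op K) -> enough_injectives K.
Proof.
move=> eP M; have [L [I [p [i [/ses_op ip /op_injective iI]]]]] := eP M.
by exists I, L, i, p.
Qed.

Lemma op_enough_projectives : enough_projectives K -> enough_injectives (op K).
Proof.
move=> eP M; have [N [P [i [p [ip pP]]]]] := eP M.
exists P, N, p, i; split; first exact: op_ses.
exact/op_projective.
Qed.

Lemma ExtP_injdim n k M H :
  @res (op K) (projective (op K)) n H -> ExtP (n + k) M H.
Proof.
elim: n H => [|n IHn] H; first by move=> /op_injective; exact: ExtP_injective.
move=> [L [I [p [i [/ses_op ip /op_injective iI /IHn ML]]]]].
by apply: (ExtP_shift ip ML); exact: ExtP_injective.
Qed.

End ExtDual.

(** * Comparison with Yoneda Ext *)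

Section Comparison.
Variable K : preadditive.
Hypothesis hK : abelian K.
Implicit Types A B C D G H I J L M P Q X Y Z : K.

Record proj_resolution M := ProjResolution {
  pr_obj :> nat -> K;
  pr_d : forall k, hom (pr_obj k.+1) (pr_obj k);
  pr_aug : hom (pr_obj 0%N) M;
  pr_exact : left_resolution pr_d pr_aug;
  pr_proj : forall k, projective K (pr_obj k)
}.

Arguments pr_proj {M} _ _ [B C g] f _.

Lemma exists_proj_resolution M :
  enough_projectives K -> inhabited (proj_resolution M).
Proof.
move=> eP; pose N M := cid (eP M).
pose P M := cid (svalP (N M)); pose i M := cid (svalP (P M)).
pose p M := cid (svalP (i M)).
have ses_ip L : ses (sval (i L)) (sval (p L)) by case: (svalP (p L)).
have proj_P L : projective K (sval (P L)) by case: (svalP (p L)).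
pose W k := iter k (fun L => sval (N L)) M.
have ex k : exact_at (sval (i (W k)) \oc sval (p (W k.+1))) (sval (p (W k))).
  exists (W k.+1), (sval (i (W k))), (sval (p (W k.+1))); split=> //.
    by case: (ses_ip (W k)).
  exact: ses_epi (ses_ip _).
have exd k : exact_at (sval (i (W k.+1)) \oc sval (p (W k.+2)))
    (sval (i (W k)) \oc sval (p (W k.+1))).
  have [L [j [e [[pj kj] ee de]]]] := ex k.+1; exists L, j, e; split=> //.
  split=> [|Z u]; first by rewrite -compA pj compm0.
  by rewrite -compA => /(ses_inj (ses_ip _))/kj.
split; apply: (@ProjResolution M (fun k => sval (P (W k)))
  (fun k => sval (i (W k)) \oc sval (p (W k.+1))) (sval (p M))) => //.
by split=> //; exact: (ses_epi (ses_ip M)).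
Qed.

Definition chain_map A (R : proj_resolution A) (C : nat -> K)
    (d : forall k, hom (C k.+1) (C k)) (e : hom (C 0%N) A)
    (g : forall k, hom (R k) (C k)) : Prop :=
  (forall k, g k \oc pr_d R k = d k \oc g k.+1) /\ e \oc g 0%N = pr_aug R.

Arguments chain_map {A} R {C} d e g.

Section ComparisonTheorem.
Variables (A : K) (R : proj_resolution A) (C : nat -> K).
Variables (d : forall k, hom (C k.+1) (C k)) (e : hom (C 0%N) A).
Hypothesis Cres : left_resolution d e.

Lemma chain_map_exists : exists g, chain_map R d e g.
Proof.
have [ee ex exd] := Cres; have [ee' ex' exd'] := pr_exact R.
(* The components are chosen one by one among those that can be continued. *)
pose good k (g : hom (R k) (C k)) := exists h, g \oc pr_d R k = d k \oc h.
have [g0 eg0] := pr_proj R 0 (pr_aug R) ee.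
have good0 : @good 0%N g0.
  have [|h dh] := exact_at_proj (b := g0 \oc pr_d R 0) ex (pr_proj R 1%N).
    by rewrite compA eg0 exact_at0.
  by exists h.
have step k (g : {g | @good k g}) :
    {h : {h | @good k.+1 h} | sval g \oc pr_d R k = d k \oc sval h}.
  have [h gh] := cid (svalP g).
  suff goodh : @good k.+1 h by exists (exist _ h goodh).
  have [|h' dh'] := exact_at_proj (b := h \oc pr_d R k.+1) (exd k)
      (pr_proj R k.+2).
    by rewrite compA -gh -compA (exact_at0 (exd' k)) compm0.
  by exists h'.
pose G := nat_rect (fun k => {g | @good k g}) (exist _ g0 good0)
  (fun k g => sval (step k g)).
exists (fun k => sval (G k)); split=> // k; exact: svalP (step k (G k)).
Qed.

Lemma chain_map_homotopy g g' : chain_map R d e g -> chain_map R d e g' ->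
  forall k, exists s t,
    g k.+1 - g' k.+1 = s \oc pr_d R k + d k.+1 \oc t.
Proof.
move=> [gd eg] [gd' eg'] k; have [ee ex exd] := Cres.
have [_ ex' exd'] := pr_exact R.
have dd j : (g j.+1 - g' j.+1) \oc pr_d R j.+1 =
    d j.+1 \oc (g j.+2 - g' j.+2).
  by rewrite compBm compmB gd gd'.
elim: k => [|k [s [t st]]].
  have [|s ds] := exact_at_proj (b := g 0%N - g' 0%N) ex (pr_proj R 0).
    by rewrite compmB eg eg' subrr.
  have [|t dt] := exact_at_proj (b := g 1%N - g' 1%N - s \oc pr_d R 0) (exd 0%N)
    (pr_proj R 1%N).
    by rewrite compmB compA ds compmB compBm gd gd' subrr.
  by exists s, t; rewrite dt [RHS]addrC subrK.
have [|t' dt'] := exact_at_proj (b := g k.+2 - g' k.+2 - t \oc pr_d R k.+1)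
    (exd k.+1) (pr_proj R k.+2).
  rewrite compmB -dd st compDl -!compA (exact_at0 (exd' k)) compm0 add0r.
  by rewrite subrr.
by exists t, t'; rewrite dt' [RHS]addrC subrK.
Qed.

End ComparisonTheorem.

(** Every cocycle is the class of a Yoneda extension: for [n] = 0 the extension
    is a pushout of the first syzygy sequence, and splicing this sequence
    raises [n]. *)
Lemma cocycle_realized n A B (C : nat -> K) d e (f : hom (C n.+1) B) :
  @left_resolution K A C d e -> f \oc d n.+1 = 0 ->
  exists (E : extension n.+1 A B) (g : forall k, hom (C k) (ext_obj E k)),
    [/\ forall k, g k \oc d k = ext_d E k \oc g k.+1,
        ext_aug E \oc g 0%N = e & g n.+1 = ext_end E \oc f].
Proof.
elim: n A C d e f => [|n IHn] A C d e f Cres fd0;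
  have [N [k [e' [ke dk Nres]]]] := left_resolution_shift hK Cres.
  have [f' f'e] : exists f' : hom N B, f' \oc e' = f.
    have [ee' ex' _] := Nres; have [L [l le]] := ses_of_epi hK ee'.
    apply: (ses_coker le).
    have [Y [p [a [ep da]]]] := exact_at_lift hK ex' (ses_comp0 le).
    by apply: ep; rewrite -compA -da compA fd0 !comp0m.
  have [D [i [p [b [ip pb bk]]]]] := push hK f' ke.
  have [Z Z0] := has_zero hK.
  have R := left_resolution_scons ip (left_resolution_triv B Z0).
  have iB : iso (idm B) by exists (idm B); rewrite comp1m.
  unshelve eexists.
    by refine (@Extension _ 1 A B _ _ p (idm B) R iB _); case=> [|[|j]].
  exists (fun j => match j return hom (C j) (scons D (scons B (fun=> Z)) j) with
    0 => b | 1 => f | j'.+2 => 0 end).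
  rewrite /=; split=> //; last by rewrite comp1m.
  case=> [|[|j]] /=; first by rewrite dk compA bk compm1 -compA f'e.
    by rewrite fd0 compm0.
  by rewrite comp0m compm0.
have [E [g [gd eg gf]]] := IHn N _ _ _ f Nres fd0.
have R := left_resolution_scons ke (ext_exact E).
unshelve eexists.
  refine (@Extension _ n.+2 A B _ _ e (ext_end E) R (ext_iso E) _).
  by case=> [|j] // nj; exact: (ext_bound E nj).
exists (fun j => match j return hom (C j) (scons (C 0%N) (ext_obj E) j) with
  0 => idm (C 0%N) | j'.+1 => g j' end).
rewrite /=; split=> //; last by rewrite compm1.
by case=> [|j] /=; [rewrite comp1m dk -compA eg | exact: gd].
Qed.

(** The class of an extension, that is, the cocycles obtained by mapping [R] to
    it, is a coset of the coboundaries, and morphisms of extensions preserve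
    it. The extension realizing [f] is linked to the one realizing 0. *)
Lemma Ext_vanish_cocycle n A B (R : proj_resolution A) (f : hom (R n.+1) B) :
  Ext_vanish n.+1 A B -> f \oc pr_d R n.+1 = 0 ->
  exists s, f = s \oc pr_d R n.
Proof.
move=> AB fd0.
pose cls (E : extension n.+1 A B) (f : hom (R n.+1) B) := exists2 g,
  chain_map R (ext_d E) (ext_aug E) g & g n.+1 = ext_end E \oc f.
have [E0 [g0 [gd0 eg0 gf0]]] := cocycle_realized (pr_exact R)
  (comp0m B (pr_d R n.+1)).
have [E [g [gd eg gf]]] := cocycle_realized (pr_exact R) fd0.
have clsE E' f1 f2 : cls E' f1 -> cls E' f2 ->
    exists s, f1 - f2 = s \oc pr_d R n.
  move=> [g1 g1c g1f] [g2 g2c g2f].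
  have [s [t st]] := chain_map_homotopy (ext_exact E') g1c g2c n.
  have [h [he _]] := ext_iso E'; exists (h \oc s).
  have t0 : ext_d E' n.+1 \oc t = 0.
    by rewrite ((ext_bound E' (ltnSn n.+1)).1 _ t) compm0.
  rewrite -compA; move: st; rewrite t0 addr0 => <-.
  by rewrite g1f g2f -compmB compA he comp1m.
pose T (E : extension n.+1 A B) :=
  forall f, cls E f -> exists s, f = s \oc pr_d R n.
suff : T E by apply; exists g.
apply: (@Ext_vanish_invariant _ _ _ _ T E0 E AB) =>
    [F F' [u [ud ua ue]]|f1 clsf1].
  have push f1 : cls F f1 -> cls F' f1.
    move=> [h [hd he] hf]; exists (fun k => u k \oc h k); last first.
      by rewrite hf compA ue.
    by split=> [k|]; [rewrite -compA hd compA ud compA | rewrite compA ua].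
  split=> TF f1 clsf1; last exact/TF/push.
  have [h hc] := chain_map_exists R (ext_exact F).
  have [v [_ ev]] := ext_iso F.
  have clsh : cls F (v \oc h n.+1) by exists h; rewrite // compA ev comp1m.
  have [s hs] := TF _ clsh; have [t ft] := clsE _ _ _ clsf1 (push _ clsh).
  by exists (s + t); rewrite compDl -hs -ft addrC subrK.
have [|s fs] := clsE E0 f1 0 clsf1; first by exists g0.
by exists s; rewrite -fs subr0.
Qed.

Definition cocycles_split n A B : Prop :=
  forall (R : proj_resolution A) (f : hom (R n.+1) B), f \oc pr_d R n.+1 = 0 ->
  exists s, f = s \oc pr_d R n.

Lemma cocycles_split_ExtP n A B : enough_projectives K ->
  cocycles_split n A B -> ExtP n A B.
Proof.
move=> eP; elim: n A => [|n IHn] A AB.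
  have [R] := exists_proj_resolution A eP; have [ee ex exd] := pr_exact R.
  move=> D i p ip; have [g pg] := pr_proj R 0 (pr_aug R) (ses_epi ip).
  have [|f fi] := ses_ker ip (u := g \oc pr_d R 0).
    by rewrite compA pg exact_at0.
  have [|s fs] := AB R f.
    apply: (ses_inj ip); rewrite compA fi -compA (exact_at0 (exd 0%N)).
    by rewrite compm0.
  have [L [l le]] := ses_of_epi hK ee.
  have [|r rg] := ses_coker le (u := g - i \oc s).
    have [Y [q [a [eq da]]]] := exact_at_lift hK ex (ses_comp0 le).
    by apply: eq; rewrite -compA -da compA compBm -compA -fs fi subrr !comp0m.
  have pr : p \oc r = idm A.
    apply: ee; rewrite -compA rg compmB pg compA (ses_comp0 ip) comp0m subr0.
    by rewrite comp1m.
  by have [r' [r'i _]] := splits_retraction ip pr; exists r'.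
move=> N P i p ip pP; apply: IHn => R f fd0.
have R' : left_resolution (scons_d i (pr_d R) (pr_aug R)) p.
  exact: left_resolution_scons ip (pr_exact R).
have pR' k : projective K (scons P R k) by case: k => // k; exact: pr_proj.
exact: (AB (ProjResolution R' pR') f fd0).
Qed.

Lemma Ext_vanish_ExtP n A B : enough_projectives K ->
  Ext_vanish n.+1 A B -> ExtP n A B.
Proof.
move=> eP AB; apply: cocycles_split_ExtP => // R f.
exact: Ext_vanish_cocycle.
Qed.

End Comparison.

(** * Global dimensions *)

(** What the proof uses of an admissible pair besides the vanishing of the
    higher Ext groups. This is stated so that it also applies to GI-admissible
    pairs, in the opposite category. *)
Record GP_pair (K : preadditive) (CX CY : set K) : Prop := GPPair {
  gp_zero : forall Z, is_zero Z -> CX Z;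
  gp_ext : forall A B C (f : hom A B) (g : hom B C),
    ses f g -> CX A -> CX C -> CX B;
  gp_cogen : forall X, CX X -> exists P X' (f : hom X P) (g : hom P X'),
    [/\ ses f g, projective K P & CX X'];
  gp_proj : forall P, projective K P -> CX P /\ CY P;
  gp_E1 : forall X Y, CX X -> CY Y -> E1 X Y
}.

Section Approximation.
Variable K : preadditive.
Hypothesis hK : abelian K.
Variables CX CY : set K.
Hypothesis XY : GP_pair CX CY.
Implicit Types A B C G H M P Q X Y Z : K.

Lemma gorensteinP G : gorenstein CX CY G ->
  (exists X G' (f : hom G X) (g : hom X G'),
     [/\ ses f g, CX X & gorenstein CX CY G']) /\
  (forall Y, CY Y -> E1 G Y).
Proof.
move=> [S [twoS SG SY]]; split; last by move=> Y; exact: SY.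
have [[X [G' [f [g [fg CXX SG']]]]] _] := twoS G SG.
by exists X, G', f, g; split=> //; exists S.
Qed.

Lemma gorenstein_X X : CX X -> gorenstein CX CY X.
Proof.
move=> CXX; have [Z Z0] := has_zero hK; have CXZ := gp_zero XY Z0.
exists CX; split=> //; last exact: gp_E1 XY.
move=> H CXH; split.
  by exists H, Z, (idm H), 0; split=> //; exact: ses_zero_r.
by exists H, Z, 0, (idm H); split=> //; exact: ses_zero_l.
Qed.

(** The extensions of members of [CX] by members of [gorenstein CX CY] form a
    class whose objects embed into projectives with cokernel in the class:
    if C is such an extension, of X by G, and [CX] contains an X0 with X0/G in
    [gorenstein CX CY], then the pushout of C along G -> X0 is in [CX], hence
    embeds into a projective. *)
Lemma gorenstein_cores (V : set K) :
  (forall A B C (f : hom A B) (g : hom B C), ses f g -> V A -> V C -> V B) ->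
  (forall X, CX X -> V X) -> (forall G, gorenstein CX CY G -> V G) ->
  forall G, gorenstein CX CY G -> cores V G.
Proof.
move=> V_ext VX VG G gG.
exists [set C | exists G X (f : hom G C) (g : hom C X),
  [/\ ses f g, gorenstein CX CY G & CX X]]; split.
  have [Z Z0] := has_zero hK; exists G, Z, (idm G), 0.
  by split=> //; [exact: ses_zero_r | exact: gp_zero XY _ Z0].
move=> {gG}C {G}[G [X [f [g [fg gG CXX]]]]].
split; first exact: V_ext fg (VG _ gG) (VX _ CXX).
have [[X0 [G' [a [a' [aa CXX0 gG']]]]] _] := gorensteinP gG.
have [E [f' [g' [b [b' [fg' bb _ _]]]]]] := push_mono hK fg aa.
have [P [X' [c [c' [cc pP CXX']]]]] := gp_cogen XY (gp_ext XY fg' CXX0 CXX).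
have [D [h [k [l [cbh kl _ _]]]]] := noether hK bb cc.
by exists P, D, (c \oc b), h; split=> //; exists G', X', k, l.
Qed.

Lemma gorenstein_embedding n M : res (gorenstein CX CY) n M ->
  exists H G (f : hom M H) (g : hom H G), ses f g /\ res (projective K) n H.
Proof.
pose V : set K := [set G | forall Y, CY Y -> E1 G Y].
have V_ext A B C (f : hom A B) (g : hom B C) : ses f g -> V A -> V C -> V B.
  by move=> fg VA VC Y CYY; apply: (E1_middle hK fg); [exact: VA | exact: VC].
have V_E1 G Q : V G -> projective K Q -> E1 G Q.
  by move=> VG /(gp_proj XY)[_ CYQ]; exact: VG.
move=> Mn; have : res (cores V) n M.
  apply: res_mono Mn; apply: (gorenstein_cores V_ext).
    by move=> X CXX Y CYY; exact: (gp_E1 XY CXX CYY).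
  by move=> G /gorensteinP[].
move=> /(cores_embedding hK V_ext V_E1)[H [G [f [g [fg Hn _]]]]].
by exists H, G, f, g.
Qed.

Hypotheses (eP : enough_projectives K) (eI : enough_injectives K).
Hypothesis XY_Ext : forall n X Y, CX X -> CY Y -> ExtI n X Y.

Definition orth G : Prop := forall n Y, CY Y -> ExtI n G Y.

Lemma orth_ext A B C (f : hom A B) (g : hom B C) :
  ses f g -> orth A -> orth C -> orth B.
Proof.
move=> fg oA oC n Y CYY.
by apply: (ExtI_middle hK fg); [exact: oA | exact: oC].
Qed.

Lemma orth_kernel A B C (f : hom A B) (g : hom B C) :
  ses f g -> orth B -> orth C -> orth A.
Proof.
move=> fg oB oC n Y CYY.
by apply: (ExtI_left hK eI fg); [exact: oB | exact: oC].
Qed.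

Lemma orth_X X : CX X -> orth X.
Proof. by move=> CXX n Y; exact: XY_Ext. Qed.

Lemma gorenstein_orth G : gorenstein CX CY G -> orth G.
Proof.
move=> gG n Y CYY; elim: n G gG => [|n IHn] G [S [twoS SG SY]]; first exact: SY.
have [_ [X [G' [f [g [fg CXX SG']]]]]] := twoS G SG.
apply: (ExtI_right hK fg); last exact: XY_Ext.
by apply: IHn; exists S.
Qed.

(** On the right a coresolution is given; on the left, a projective resolution
    will do, since its syzygies stay in the class. *)
Lemma cores_orth_gorenstein G : cores orth G -> gorenstein CX CY G.
Proof.
move=> cG; exists (cores orth); split=> //; last first.
  by move=> H Y /coresP[oH _]; exact: (oH 0%N).
move=> {cG}G cG; have [oG [P [G' [f [g [fg pP cG']]]]]] := coresP cG.
split; first by exists P, G', f, g; split=> //; case: (gp_proj XY pP).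
have [N [Q [i [p [ip pQ]]]]] := eP G; have [CXQ _] := gp_proj XY pQ.
exists Q, N, i, p; split=> //; apply: (coresI ip pQ _ cG).
exact: orth_kernel ip (orth_X CXQ) oG.
Qed.

(** The syzygy is projective by induction, so that the last short exact sequence
    of the resolution splits. *)
Lemma res_projective_orth n H : res (projective K) n H ->
  (forall k Q, projective K Q -> ExtI k H Q) -> projective K H.
Proof.
elim: n H => // n IHn H [N [P [i [p [ip pP Nn]]]]] oH.
have pN : projective K N.
  apply: IHn Nn _ => k Q pQ; apply: (ExtI_left hK eI ip); last exact: oH.
  exact: ExtI_projective.
have [r ri] := oH 0%N N pN _ _ _ ip.
have [s [ps _]] := splits_section ip ri.
move=> B C g f eg; have [h gh] := pP _ _ _ (f \oc p) eg.
by exists (h \oc s); rewrite compA gh -compA ps compm1.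
Qed.

Hypothesis fin : forall M, exists n, res (gorenstein CX CY) n M.

(** In the embedding of [M] into an object H of finite projective dimension, H
    inherits the vanishing of Ext into projectives and is projective; then [M]
    inherits the orthogonality to [CY] from the cokernel. *)
Lemma ext_vanish_gorenstein M :
  (forall k Q, projective K Q -> ExtI k M Q) -> gorenstein CX CY M.
Proof.
move=> oM; have [n Mn] := fin M.
have cMn : res (cores orth) n M.
  apply: res_mono Mn; apply: gorenstein_cores; first exact: orth_ext.
    exact: orth_X.
  exact: gorenstein_orth.
have orth_E1 G Q : orth G -> projective K Q -> E1 G Q.
  by move=> oG /(gp_proj XY)[_ CYQ]; exact: (oG 0%N).
have [H [G [f [g [fg Hn cG]]]]] := cores_embedding hK orth_ext orth_E1 cMn.
have [oG _] := coresP cG.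
have pH : projective K H.
  apply: (res_projective_orth Hn) => k Q pQ; apply: (ExtI_middle hK fg).
    exact: oM.
  by apply: oG; case: (gp_proj XY pQ).
apply: cores_orth_gorenstein; have [CXH _] := gp_proj XY pH.
by apply: (coresI fg pH _ cG); exact: orth_kernel fg (orth_X CXH) oG.
Qed.

Lemma ext_vanish_resolution n M :
  (forall k Q, projective K Q -> ExtI (n + k) M Q) ->
  res (gorenstein CX CY) n M.
Proof.
elim: n M => [|n IHn] M oM; first exact: ext_vanish_gorenstein.
have [N [P [i [p [ip pP]]]]] := eP M; have [CXP _] := gp_proj XY pP.
exists N, P, i, p; split=> //; first exact: gorenstein_X.
apply: IHn => k Q pQ; apply: (ExtI_left hK eI ip); last exact: oM.
exact: ExtI_projective.
Qed.

(** By the hypothesis, Ext^i(-, Q) vanishes for i > [n] and projective Q, so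
    that the [n]-th syzygies have no Ext into projectives. *)
Lemma gorenstein_dim_le n :
  (forall Q, projective K Q -> exists (H : K) (i : hom Q H) (r : hom H Q),
     r \oc i = idm Q /\ @res (op K) (projective (op K)) n H) ->
  forall M, res (gorenstein CX CY) n M.
Proof.
move=> injdim M; apply: ext_vanish_resolution => k Q pQ.
have [H [i [r [ri Hn]]]] := injdim Q pQ.
apply/(ExtIP hK eP eI); apply: (ExtP_retract hK ri).
exact: ExtP_injdim.
Qed.

End Approximation.

Lemma retract_of_embedding (K : preadditive) (n : nat) (Q : K) :
  projective K Q ->
  (exists (H G : op K) (f : @hom (op K) Q H) (g : @hom (op K) H G),
     ses f g /\ @res (op K) (projective (op K)) n H) ->
  exists (H : K) (i : hom Q H) (r : hom H Q),
     r \oc i = idm Q /\ @res (op K) (projective (op K)) n H.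
Proof.
move=> pQ [H [G [f [g [/ses_op fg Hn]]]]].
by have [s fs] := pQ _ _ _ (idm Q) (ses_epi fg); exists H, s, f.
Qed.

(** * The two sides of the theorem *)

Lemma coproduct_closed0 (K : preadditive) (C : set K) (Z : K) :
  coproduct_closed C -> is_zero Z -> C Z.
Proof.
move=> CC Z0; apply: (CC 0%N (fun=> Z) Z (fun=> idm Z)) => [A u|[]//].
by exists 0; split=> [[]//|v _]; rewrite (Z0.2 _ v).
Qed.

Lemma GP_admissible_pair (K : preadditive) (hK : abelian K) (CX CY : set K) :
  GP_admissible CX CY -> CX `&` CY = projective K -> GP_pair CX CY.
Proof.
move=> [epiX coX coY extX cogX XY] proj; split.
- by move=> Z; exact: coproduct_closed0.
- by move=> A B C f g /(short_exactP hK); exact: extX.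
- move=> X /cogX[P [X' [f [g [/(short_exactP hK) fg]]]]].
  by rewrite proj => pP CXX'; exists P, X', f, g.
- by move=> P; rewrite -proj => -[].
- by move=> X Y CXX CYY; apply: Ext_vanish_E1 => //; exact: XY.
Qed.

Lemma GI_admissible_pair (K : preadditive) (hK : abelian K) (CZ CW : set K) :
  GI_admissible CZ CW -> CZ `&` CW = injective_obj K -> @GP_pair (op K) CW CZ.
Proof.
move=> [monoW coZ coW extW genW ZW] inj; split.
- by move=> Z /op_zero; exact: coproduct_closed0.
- move=> A B C f g /ses_op/(short_exactP hK) fg CWA CWC.
  exact: extW fg CWC CWA.
- move=> W /genW[V [W' [f [g [/(short_exactP hK) fg]]]]].
  rewrite inj => /op_injective iV CWW'; exists V, W', g, f.
  by split=> //; exact: op_ses.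
- by move=> I /op_injective; rewrite -inj => -[].
- move=> W Z CWW CZZ; apply/op_E1; apply: Ext_vanish_E1 => //; exact: ZW.
Qed.

Lemma enat_least_finite (P : set nat) : enat_least P <> einfty -> exists n, P n.
Proof.
by rewrite /enat_least; case: pselect => // -[n /asboolP Pn] _; exists n.
Qed.

Lemma enat_least_le (P : set nat) n :
  (forall m k, (m <= k)%N -> P m -> P k) ->
  le_enat (enat_least P) (Some n) <-> P n.
Proof.
move=> Pmono; rewrite /enat_least; case: pselect => [h|nh] /=; last first.
  by split=> // Pn; apply: nh; exists n; apply/asboolP.
case: ex_minnP => m /asboolP Pm minm; split=> [mn|Pn]; first exact: Pmono Pm.
by apply: minm; apply/asboolP.
Qed.

Lemma enat_eq (x y : enat) :
  (forall n, le_enat x (Some n) <-> le_enat y (Some n)) -> x = y.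
Proof.
case: x y => [m|] [n|] //= xy.
- by congr Some; apply/eqP; rewrite eqn_leq (iffRL (xy n)) // (iffLR (xy m)).
- by have := iffLR (xy m) (leqnn m).
- by have := iffRL (xy n) (leqnn n).
Qed.

Lemma enat_sup_le (S : set enat) n :
  le_enat (enat_sup S) (Some n) <-> forall x, S x -> le_enat x (Some n).
Proof.
split=> [Sn x Sx|]; last exact: enat_sup_least.
have := enat_sup_ub Sx; move: (enat_sup S) Sn x {Sx} => [s|] // sn [x|] //= xs.
exact: leq_trans xs sn.
Qed.

Lemma sup_enat_least_le (T : Type) (P : T -> set nat) n :
  (forall x m k, (m <= k)%N -> P x m -> P x k) ->
  le_enat (enat_sup (range (fun x => enat_least (P x)))) (Some n) <->
  forall x, P x n.
Proof.
move=> Pmono; split=> [/enat_sup_le Sn x | Pn].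
  by apply/enat_least_le; [exact: Pmono | exact: Sn (imageT _ x)].
apply/enat_sup_le => _ [x _ <-].
by apply/enat_least_le; [exact: Pmono | exact: Pn].
Qed.

Theorem corollary3p5 (A : preadditive) (hA : abelian A) (X Y Z W : set A)
  (hXY : GP_admissible X Y) (hXYproj : X `&` Y = projective A)
  (hZW : GI_admissible Z W) (hZWinj : Z `&` W = injective_obj A)
  (hGP : wedge (GP X Y) = setT) (hGI : vee (GI Z W) = setT) :
  glGPD X Y = glGID Z W.
Proof.
have XY := GP_admissible_pair hA hXY hXYproj.
have WZ := GI_admissible_pair hA hZW hZWinj.
have hAop := op_abelian hA.
have GPE : GP X Y = gorenstein X Y by exact: (GP_gorenstein hA (gp_E1 XY)).
have GIE : GI Z W = @gorenstein (op A) W Z.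
  apply: (GI_gorenstein hA) => C D CC DD.
  by apply/op_E1; exact: gp_E1 WZ _ _ DD CC.
have resP n M : has_resolution (GP X Y) M n <-> res (gorenstein X Y) n M.
  by rewrite -GPE; apply: has_resolutionP => //; exact: GP_iso.
have coresP n M : has_coresolution (GI Z W) M n <->
    @res (op A) (@gorenstein (op A) W Z) n M.
  rewrite -GIE; apply: (iff_trans (has_coresolution_op hA _ _ _)).
  apply: (has_resolutionP hAop) => C D f [g [gf fg]].
  by apply: (@GI_iso A Z W C D g); exists f.
have zeroG C : is_zero C -> gorenstein X Y C.
  by move=> C0; exact: (gorenstein_X hA XY (gp_zero XY C0)).
have zeroGop C : @is_zero (op A) C -> @gorenstein (op A) W Z C.
  by move=> C0; exact: (gorenstein_X hAop WZ (gp_zero WZ C0)).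
have fin M : exists n, res (gorenstein X Y) n M.
  have : wedge (GP X Y) M by rewrite hGP.
  by move=> /enat_least_finite[n /resP]; exists n.
have finop M : exists n, @res (op A) (@gorenstein (op A) W Z) n M.
  have : vee (GI Z W) M by rewrite hGI.
  by move=> /enat_least_finite[n /coresP]; exists n.
have emb M : exists n H (f : hom M H), mono f /\ res (projective A) n H.
  have [n Mn] := fin M.
  have [H [G [f [g [fg Hn]]]]] := gorenstein_embedding hA XY Mn.
  by exists n, H, f; split=> //; exact: ses_mono fg.
have embop (M : op A) : exists n (H : op A) (f : hom M H),
    mono f /\ res (projective (op A)) n H.
  have [n Mn] := finop M.
  have [H [G [f [g [fg Hn]]]]] := gorenstein_embedding hAop WZ Mn.
  by exists n, H, f; split=> //; exact: ses_mono fg.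
have eP : enough_projectives A := enough_projectivesP hA emb embop.
have ePop : enough_projectives (op A) := enough_projectivesP hAop embop emb.
have eI := op_enough_injectives ePop; have eIop := op_enough_projectives eP.
have XYExt n C D : X C -> Y D -> ExtI n C D.
  move=> XC YD; apply/(ExtIP hA eP eI); apply: (Ext_vanish_ExtP hA eP).
  exact: (GPa_perp hXY).
have WZExt n (C D : op A) : W C -> Z D -> ExtI n C D.
  move=> WC ZD; apply/op_ExtI; apply: (Ext_vanish_ExtP hA eP).
  exact: (GIa_perp hZW).
have half n : (forall M, @res (op A) (@gorenstein (op A) W Z) n M) ->
    forall M, res (gorenstein X Y) n M.
  move=> Hn; apply: (gorenstein_dim_le hA XY eP eI XYExt fin) => Q pQ.
  exact/(retract_of_embedding pQ)/(gorenstein_embedding hAop WZ).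
have halfop n : (forall M, res (gorenstein X Y) n M) ->
    forall M, @res (op A) (@gorenstein (op A) W Z) n M.
  move=> Hn; apply: (gorenstein_dim_le hAop WZ ePop eIop WZExt finop) => Q pQ.
  exact/(retract_of_embedding pQ)/(gorenstein_embedding hA XY).
apply: enat_eq => n.
have resS M m k : (m <= k)%N ->
    has_resolution (GP X Y) M m -> has_resolution (GP X Y) M k.
  by move=> mk /resP Mm; apply/resP; exact: (res_leq hA zeroG mk Mm).
have coresS M m k : (m <= k)%N ->
    has_coresolution (GI Z W) M m -> has_coresolution (GI Z W) M k.
  by move=> mk /coresP Mm; apply/coresP; exact: (res_leq hAop zeroGop mk Mm).
split=> /sup_enat_least_le Hn; apply/sup_enat_least_le => // M.
  by apply/coresP/halfop => M'; apply/resP/Hn.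
by apply/resP/half => M'; apply/coresP/Hn.
Qed.
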